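(* The following claim is false: for every category $\mathsf{M}$ and every algebraic weak factorization system $(\mathbb{L},\mathbb{R})$ on $\mathsf{M}$, (i) for every left adjoint functor $V \colon \mathsf{K} \to \mathsf{M}$ along which the left-lifting $(\mathbb{L}',\mathbb{R}')$ of the algebraic weak factorization system $(\mathbb{L},\mathbb{R})$ exists, the underlying weak factorization system of $(\mathbb{L}',\mathbb{R}')$ is the left-lifting along $V$ of the underlying weak factorization system of $(\mathbb{L},\mathbb{R})$; and (ii) for every right adjoint functor $U \colon \mathsf{C} \to \mathsf{M}$ along which the right-lifting $(\mathbb{L}'',\mathbb{R}'')$ of the algebraic weak factorization system $(\mathbb{L},\mathbb{R})$ exists, the underlying weak factorization system of $(\mathbb{L}'',\mathbb{R}'')$ is the right-lifting along $U$ of the underlying weak factorization system of $(\mathbb{L},\mathbb{R})$.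
   Context: Lifting of weak factorization systems. $\mathrm{llp}(\mathcal{X})$, $\mathrm{rlp}(\mathcal{X})$ denote the classes of maps with the left, right lifting property against a class $\mathcal{X}$; $H^{-1}\mathcal{X}$ is the class of maps sent into $\mathcal{X}$ by a functor $H$. The left-lifting of a weak factorization system $(\mathcal{L},\mathcal{R})$ on $\mathsf{M}$ along $V\colon \mathsf{K}\to\mathsf{M}$ is, if it exists, the weak factorization system $(V^{-1}\mathcal{L}, \mathrm{rlp}(V^{-1}\mathcal{L}))$ on $\mathsf{K}$; the right-lifting along $U\colon\mathsf{C}\to\mathsf{M}$ is, if it exists, $(\mathrm{llp}(U^{-1}\mathcal{R}), U^{-1}\mathcal{R})$ on $\mathsf{C}$. Algebraic weak factorization systems. $\mathsf{M}^{\mathbf 2}$ is the arrow category. A functorial factorization on $\mathsf{M}$ assigns to each $f\colon X\to Y$, functorially in $f\in\mathsf{M}^{\mathbf 2}$, a factorization $X\xrightarrow{Lf}Ef\xrightarrow{Rf}Y$ of $f$; this gives a functor $E\colon\mathsf{M}^{\mathbf 2}\to\mathsf{M}$, endofunctors $L,R$ of $\mathsf{M}^{\mathbf 2}$, and natural transformations $\vec\eta\colon 1\Rightarrow R$, $\vec\epsilon\colon L\Rightarrow 1$ with $\vec\eta_f=(Lf,1)\colon f\to Rf$ and $\vec\epsilon_f=(1,Rf)\colon Lf\to f$. An algebraic weak factorization system $(\mathbb{L},\mathbb{R})$ on $\mathsf{M}$ is a comonad $\mathbb{L}=(L,\vec\epsilon,\vec\delta)$ and a monad $\mathbb{R}=(R,\vec\eta,\vec\mu)$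 on $\mathsf{M}^{\mathbf 2}$ with $L,R,\vec\epsilon,\vec\eta$ arising from a functorial factorization in this way, such that, writing $\vec\delta_f=(1,\delta_f)\colon Lf\to LLf$ with $\delta_f\colon Ef\to ELf$ and $\vec\mu_f=(\mu_f,1)\colon RRf\to Rf$ with $\mu_f\colon ERf\to Ef$, the maps $(\delta_f,\mu_f)\colon LRf\to RLf$ constitute a distributive law of the comonad $\mathbb{L}$ over the monad $\mathbb{R}$. Its underlying weak factorization system $(\mathcal{L},\mathcal{R})$ has as $\mathcal{L}$ the maps $f\colon A\to B$ admitting an $(L,\vec\epsilon)$-coalgebra structure ($s\colon B\to Ef$ with $sf=Lf$, $Rf\cdot s=1$), and as $\mathcal{R}$ the maps $g\colon C\to D$ admitting an $(R,\vec\eta)$-algebra structure ($p\colon Eg\to C$ with $p\cdot Lg=1$, $g p=Rg$). Double categories of coalgebras and algebras. A double category is an internal category in $\mathsf{CAT}$. $\mathbb{S}\mathsf{q}(\mathsf{M})$ is the double category whose objects are those of $\mathsf{M}$, whose horizontal and vertical arrows are both the arrows of $\mathsf{M}$, and whose squares are the commutative squares. $\mathbb{C}\mathsf{oalg}_{\mathbb{L}}$ is the double category with objects and horizontal arrows those of $\mathsf{M}$, vertical arrows the coalgebras $(f,s)$ for the comonad $\mathbb{L}$, and squares the maps of $\mathbb{L}$-coalgebras. Vertical composition of $(f,s)\colon A\to B$ with $(g,t)\colon B\to C$ is $(gf,\ \mu_{gf}\cdot E(w,1_C)\cdot t)$, where $w=\mu_{gf}\cdot E(L(gf),g)\cdot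 s\colon B\to E(gf)$, and the vertical identity at $A$ is $(1_A,L1_A)$. $\mathbb{A}\mathsf{lg}^{\mathbb{R}}$ is the double category with objects and horizontal arrows those of $\mathsf{M}$, vertical arrows the algebras $(f,p)$ for the monad $\mathbb{R}$, and squares the maps of $\mathbb{R}$-algebras; vertical composition of $(f,p)\colon A\to B$ with $(g,q)\colon B\to C$ is $(gf,\ p\cdot E(1_A,v)\cdot\delta_{gf})$, where $v=q\cdot E(f,R(gf))\cdot\delta_{gf}\colon E(gf)\to B$, and the vertical identity at $A$ is $(1_A,R1_A)$. Both have forgetful double functors to $\mathbb{S}\mathsf{q}(\mathsf{M})$. Lifting of algebraic weak factorization systems. The left-lifting of $(\mathbb{L},\mathbb{R})$ along a left adjoint $V\colon\mathsf{K}\to\mathsf{M}$ is, when it exists, the algebraic weak factorization system $(\mathbb{L}',\mathbb{R}')$ on $\mathsf{K}$ characterised by $\mathbb{C}\mathsf{oalg}_{\mathbb{L}'}\to\mathbb{S}\mathsf{q}(\mathsf{K})$ being the pullback (of double categories) of $\mathbb{C}\mathsf{oalg}_{\mathbb{L}}\to\mathbb{S}\mathsf{q}(\mathsf{M})$ along $\mathbb{S}\mathsf{q}(V)$. The right-lifting along a right adjoint $U\colon\mathsf{C}\to\mathsf{M}$ is, when it exists, the algebraic weak factorization system $(\mathbb{L}'',\mathbb{R}'')$ on $\mathsf{C}$ characterised by $\mathbb{A}\mathsf{lg}^{\mathbb{R}''}\to\mathbb{S}\mathsf{q}(\mathsf{C})$ being the pullback of $\mathbb{A}\mathsf{lg}^{\mathbb{R}}\to\mathbb{S}\mathsf{q}(\mathsf{M})$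 along $\mathbb{S}\mathsf{q}(U)$. *)

(* Defs.v *)
From Stdlib Require Import ssreflect ssrfun ProofIrrelevance.

Set Implicit Arguments.
Unset Strict Implicit.
Unset Printing Implicit Defensive.

Local Obligation Tactic := cbn; intros.

Record Category := MkCategory {
  Ob :> Type;
  Hom : Ob -> Ob -> Type;
  idm : forall A, Hom A A;
  comp : forall A B C, Hom B C -> Hom A B -> Hom A C;
  comp_idl : forall A B (f : Hom A B), comp (idm B) f = f;
  comp_idr : forall A B (f : Hom A B), comp f (idm A) = f;
  comp_assoc : forall A B C D (h : Hom C D) (g : Hom B C) (f : Hom A B),
    comp h (comp g f) = comp (comp h g) f }.

Arguments Hom {c} A B.
Arguments idm {c} A.
Arguments comp {c A B C} g f.

Notation "g ∘ f" := (comp g f) (at level 40, left associativity).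

Record Functor (C D : Category) := MkFunctor {
  fob :> C -> D;
  fmap : forall A B : C, Hom A B -> Hom (fob A) (fob B);
  fmap_id : forall A : C, fmap (idm A) = idm (fob A);
  fmap_comp : forall (X Y Z : C) (g : Hom Y Z) (f : Hom X Y),
    fmap (g ∘ f) = fmap g ∘ fmap f }.

Arguments fmap {C D} _ {A B} _.

Definition functor_id (C : Category) : Functor C C :=
  @MkFunctor C C (fun A => A) (fun _ _ f => f)
    (fun _ => erefl) (fun _ _ _ _ _ => erefl).

Program Definition functor_comp (C D E : Category)
    (G : Functor D E) (F : Functor C D) : Functor C E :=
  @MkFunctor C E (fun A => G (F A)) (fun _ _ f => fmap G (fmap F f)) _ _.
Next Obligation. by rewrite !fmap_id. Qed.
Next Obligation. by rewrite !fmap_comp. Qed.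

Record NatTrans (C D : Category) (F G : Functor C D) := MkNatTrans {
  nt :> forall A : C, Hom (F A) (G A);
  nt_nat : forall (A B : C) (f : Hom A B), nt B ∘ fmap F f = fmap G f ∘ nt A }.

Record Adjunction (C D : Category) (F : Functor C D) (G : Functor D C) :=
  MkAdjunction {
  adj_unit : NatTrans (functor_id C) (functor_comp G F);
  adj_counit : NatTrans (functor_comp F G) (functor_id D);
  adj_triangle_l : forall A : C, adj_counit (F A) ∘ fmap F (adj_unit A) = idm (F A);
  adj_triangle_r : forall B : D, fmap G (adj_counit B) ∘ adj_unit (G B) = idm (G B) }.

Definition is_left_adjoint (C D : Category) (F : Functor C D) : Prop :=
  exists G : Functor D C, inhabited (Adjunction F G).

Definition is_right_adjoint (D C : Category) (G : Functor D C) : Prop :=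
  exists F : Functor C D, inhabited (Adjunction F G).

Record IsComonad (C : Category) (G : Functor C C)
    (eps : NatTrans G (functor_id C)) (del : NatTrans G (functor_comp G G)) :
    Prop := {
  comonad_counit_l : forall A, eps (G A) ∘ del A = idm (G A);
  comonad_counit_r : forall A, fmap G (eps A) ∘ del A = idm (G A);
  comonad_coassoc : forall A, del (G A) ∘ del A = fmap G (del A) ∘ del A }.

Record IsMonad (C : Category) (T : Functor C C)
    (eta : NatTrans (functor_id C) T) (mu : NatTrans (functor_comp T T) T) :
    Prop := {
  monad_unit_l : forall A, mu A ∘ eta (T A) = idm (T A);
  monad_unit_r : forall A, mu A ∘ fmap T (eta A) = idm (T A);
  monad_assoc : forall A, mu A ∘ mu (T A) = mu A ∘ fmap T (mu A) }.

Record IsDistributiveLaw (C : Category) (G T : Functor C C)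
    (eps : NatTrans G (functor_id C)) (del : NatTrans G (functor_comp G G))
    (eta : NatTrans (functor_id C) T) (mu : NatTrans (functor_comp T T) T)
    (lam : NatTrans (functor_comp G T) (functor_comp T G)) : Prop := {
  dist_unit : forall A, lam A ∘ fmap G (eta A) = eta (G A);
  dist_mult : forall A,
    lam A ∘ fmap G (mu A) = mu (G A) ∘ fmap T (lam A) ∘ lam (T A);
  dist_counit : forall A, fmap T (eps A) ∘ lam A = eps (T A);
  dist_comult : forall A,
    fmap T (del A) ∘ lam A = lam (G A) ∘ fmap G (lam A) ∘ del (T A) }.

#[projections(primitive)]
Record Arr (M : Category) := MkArr { dom : M; cod : M; arr : Hom dom cod }.

Arguments MkArr {M dom cod} arr.

#[projections(primitive)]
Record Square (M : Category) (f g : Arr M) := MkSquare {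
  top : Hom (dom f) (dom g);
  bot : Hom (cod f) (cod g);
  sq_comm : arr g ∘ top = bot ∘ arr f }.

Arguments MkSquare {M f g} top bot sq_comm.

Lemma sq_eq (M : Category) (f g : Arr M) (s t : Square f g) :
  top s = top t -> bot s = bot t -> s = t.
Proof.
case: s t => [h k H] [h' k' H'] /= e e'; subst.
by rewrite (proof_irrelevance _ H H').
Qed.

Program Definition sq_id (M : Category) (f : Arr M) : Square f f :=
  MkSquare (idm (dom f)) (idm (cod f)) _.
Next Obligation. by rewrite comp_idl comp_idr. Qed.

Program Definition sq_hcomp (M : Category) (f g h : Arr M)
    (t : Square g h) (s : Square f g) : Square f h :=
  MkSquare (top t ∘ top s) (bot t ∘ bot s) _.
Next Obligation.
by rewrite comp_assoc sq_comm -comp_assoc sq_comm comp_assoc.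
Qed.

Program Definition ArrowCat (M : Category) : Category :=
  @MkCategory (Arr M) (@Square M) (@sq_id M) (@sq_hcomp M) _ _ _.
Next Obligation. by apply: sq_eq; rewrite /= comp_idl. Qed.
Next Obligation. by apply: sq_eq; rewrite /= comp_idr. Qed.
Next Obligation. by apply: sq_eq; rewrite /= comp_assoc. Qed.

Definition arr_map (C D : Category) (F : Functor C D) (f : Arr C) : Arr D :=
  MkArr (fmap F (arr f)).

Definition MorClass (M : Category) := forall A B : M, Hom A B -> Prop.

Definition class_eq (M : Category) (X Y : MorClass M) : Prop :=
  forall (A B : M) (f : Hom A B), X A B f <-> Y A B f.

Definition lifts (M : Category) (A B C D : M) (f : Hom A B) (g : Hom C D) :=
  forall (u : Hom A C) (v : Hom B D), g ∘ u = v ∘ f ->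
  exists d : Hom B C, d ∘ f = u /\ g ∘ d = v.

Definition llp (M : Category) (X : MorClass M) : MorClass M :=
  fun A B f => forall (C D : M) (g : Hom C D), X C D g -> lifts f g.

Definition rlp (M : Category) (X : MorClass M) : MorClass M :=
  fun C D g => forall (A B : M) (f : Hom A B), X A B f -> lifts f g.

Definition preimage (C D : Category) (H : Functor C D) (X : MorClass D) :
  MorClass C := fun A B f => X (H A) (H B) (fmap H f).

Record IsWFS (M : Category) (L R : MorClass M) : Prop := {
  wfs_fact : forall (A B : M) (f : Hom A B),
    exists (E : M) (l : Hom A E) (r : Hom E B), L A E l /\ R E B r /\ r ∘ l = f;
  wfs_left : class_eq L (llp R);
  wfs_right : class_eq R (rlp L) }.

Record WFS (M : Category) := MkWFS {
  left_class : MorClass M;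
  right_class : MorClass M;
  wfsP : IsWFS left_class right_class }.

Definition is_wfs_left_lifting (K M : Category) (V : Functor K M)
    (w : WFS M) (w' : WFS K) : Prop :=
  class_eq (left_class w') (preimage V (left_class w)) /\
  class_eq (right_class w') (rlp (preimage V (left_class w))).

Definition is_wfs_right_lifting (C M : Category) (U : Functor C M)
    (w : WFS M) (w' : WFS C) : Prop :=
  class_eq (left_class w') (llp (preimage U (right_class w))) /\
  class_eq (right_class w') (preimage U (right_class w)).

Record FunctorialFactorization (M : Category) := MkFF {
  ffE :> Functor (ArrowCat M) M;
  ffl : forall f : Arr M, Hom (dom f) (ffE f);
  ffr : forall f : Arr M, Hom (ffE f) (cod f);
  ff_fact : forall f : Arr M, ffr f ∘ ffl f = arr f;
  ffl_nat : forall (f g : Arr M) (s : Square f g),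
    fmap ffE s ∘ ffl f = ffl g ∘ top s;
  ffr_nat : forall (f g : Arr M) (s : Square f g),
    ffr g ∘ fmap ffE s = bot s ∘ ffr f }.

Section FF.
Variables (M : Category) (F : FunctorialFactorization M).

Definition ffL_map (f g : Arr M) (s : Square f g) :
    Square (MkArr (ffl F f)) (MkArr (ffl F g)) :=
  @MkSquare M (MkArr (ffl F f)) (MkArr (ffl F g)) (top s) (fmap F s)
    (esym (ffl_nat F s)).

Definition ffR_map (f g : Arr M) (s : Square f g) :
    Square (MkArr (ffr F f)) (MkArr (ffr F g)) :=
  @MkSquare M (MkArr (ffr F f)) (MkArr (ffr F g)) (fmap F s) (bot s)
    (ffr_nat F s).

Program Definition ffL : Functor (ArrowCat M) (ArrowCat M) :=
  @MkFunctor (ArrowCat M) (ArrowCat M) (fun f => MkArr (ffl F f)) ffL_map _ _.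
Next Obligation.
by apply: sq_eq => //=; exact: (@fmap_id (ArrowCat M) M F A).
Qed.
Next Obligation.
by apply: sq_eq => //=; exact: (@fmap_comp (ArrowCat M) M F).
Qed.

Program Definition ffR : Functor (ArrowCat M) (ArrowCat M) :=
  @MkFunctor (ArrowCat M) (ArrowCat M) (fun f => MkArr (ffr F f)) ffR_map _ _.
Next Obligation.
by apply: sq_eq => //=; exact: (@fmap_id (ArrowCat M) M F A).
Qed.
Next Obligation.
by apply: sq_eq => //=; exact: (@fmap_comp (ArrowCat M) M F).
Qed.

Program Definition ffeps : NatTrans ffL (functor_id (ArrowCat M)) :=
  @MkNatTrans (ArrowCat M) (ArrowCat M) ffL (functor_id (ArrowCat M))
    (fun f => @MkSquare M (MkArr (ffl F f)) f (idm (dom f)) (ffr F f) _) _.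
Next Obligation. by rewrite comp_idr ff_fact. Qed.
Next Obligation.
by apply: sq_eq => /=; rewrite ?comp_idl ?comp_idr ?ffr_nat.
Qed.

Program Definition ffeta : NatTrans (functor_id (ArrowCat M)) ffR :=
  @MkNatTrans (ArrowCat M) (ArrowCat M) (functor_id (ArrowCat M)) ffR
    (fun f => @MkSquare M f (MkArr (ffr F f)) (ffl F f) (idm (cod f)) _) _.
Next Obligation. by rewrite comp_idl ff_fact. Qed.
Next Obligation.
by apply: sq_eq => /=; rewrite ?comp_idl ?comp_idr ?ffl_nat.
Qed.

End FF.

(* The counit law of the comonad forces [top (awfs_delta f) = idm] and the unit
   law of the monad forces [bot (awfs_mu f) = idm] (see [delta_top], [mu_bot]),
   so [deltac] and [muc] below carry all the data. *)
Record AWFS (M : Category) := MkAWFS {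
  awfs_ff :> FunctorialFactorization M;
  awfs_delta : NatTrans (ffL awfs_ff) (functor_comp (ffL awfs_ff) (ffL awfs_ff));
  awfs_mu : NatTrans (functor_comp (ffR awfs_ff) (ffR awfs_ff)) (ffR awfs_ff);
  awfs_comonad : IsComonad (ffeps awfs_ff) awfs_delta;
  awfs_monad : IsMonad (ffeta awfs_ff) awfs_mu;
  awfs_dist : exists lam : NatTrans (functor_comp (ffL awfs_ff) (ffR awfs_ff))
                                    (functor_comp (ffR awfs_ff) (ffL awfs_ff)),
    (forall f : Arr M, top (lam f) = bot (awfs_delta f)
                       /\ bot (lam f) = top (awfs_mu f))
    /\ IsDistributiveLaw (ffeps awfs_ff) awfs_delta (ffeta awfs_ff) awfs_mu lam }.

Section AWFS.
Variables (M : Category) (W : AWFS M).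

Definition deltac (f : Arr M) : Hom (W f) (W (MkArr (ffl W f))) :=
  bot (awfs_delta W f).

Definition muc (f : Arr M) : Hom (W (MkArr (ffr W f))) (W f) :=
  top (awfs_mu W f).

Definition awfs_left : MorClass M := fun A B f =>
  exists s : Hom B (W (MkArr f)),
    s ∘ f = ffl W (MkArr f) /\ ffr W (MkArr f) ∘ s = idm B.

Definition awfs_right : MorClass M := fun C D g =>
  exists p : Hom (W (MkArr g)) C,
    p ∘ ffl W (MkArr g) = idm C /\ g ∘ p = ffr W (MkArr g).

Definition Esq (f g : Arr M) (h : Hom (dom f) (dom g)) (k : Hom (cod f) (cod g))
    (H : arr g ∘ h = k ∘ arr f) : Hom (W f) (W g) :=
  fmap W (MkSquare h k H).

Lemma Esq_eq (f g : Arr M) (s t : Square f g) :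
  top s = top t -> bot s = bot t -> fmap W s = fmap W t.
Proof. by move=> e e'; rewrite (sq_eq e e'). Qed.

Lemma E_comp (f g h : Arr M) (t : Square g h) (s : Square f g) :
  fmap W t ∘ fmap W s = fmap W (sq_hcomp t s).
Proof. by rewrite -(@fmap_comp (ArrowCat M) M W). Qed.

Lemma E_id (f : Arr M) (s : Square f f) :
  top s = idm _ -> bot s = idm _ -> fmap W s = idm (W f).
Proof.
move=> e e'; rewrite -(@fmap_id (ArrowCat M) M W f); exact: Esq_eq.
Qed.

Lemma delta_top f : top (awfs_delta W f) = idm (dom f).
Proof.
have /(f_equal (@top _ _ _)) /= := comonad_counit_l (awfs_comonad W) f.
by rewrite comp_idl.
Qed.

Lemma mu_bot f : bot (awfs_mu W f) = idm (cod f).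
Proof.
have /(f_equal (@bot _ _ _)) /= := monad_unit_l (awfs_monad W) f.
by rewrite comp_idr.
Qed.

Lemma deltaL f : deltac f ∘ ffl W f = ffl W (MkArr (ffl W f)).
Proof.
by have := sq_comm (awfs_delta W f); rewrite delta_top /= comp_idr => <-.
Qed.

Lemma deltaR f : ffr W (MkArr (ffl W f)) ∘ deltac f = idm _.
Proof.
by have /(f_equal (@bot _ _ _)) := comonad_counit_l (awfs_comonad W) f.
Qed.

Lemma muR f : ffr W f ∘ muc f = ffr W (MkArr (ffr W f)).
Proof.
by have := sq_comm (awfs_mu W f); rewrite mu_bot /= comp_idl => ->.
Qed.

Lemma muL f : muc f ∘ ffl W (MkArr (ffr W f)) = idm _.
Proof.
by have /(f_equal (@top _ _ _)) := monad_unit_l (awfs_monad W) f.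
Qed.

Lemma delta_counit f (s : Square (MkArr (ffl W f)) f) :
  top s = idm _ -> bot s = ffr W f -> fmap W s ∘ deltac f = idm _.
Proof.
have /(f_equal (@bot _ _ _)) /= <- := comonad_counit_r (awfs_comonad W) f.
by move=> e e'; congr (_ ∘ _); exact: Esq_eq.
Qed.

Lemma mu_unit f (s : Square f (MkArr (ffr W f))) :
  top s = ffl W f -> bot s = idm _ -> muc f ∘ fmap W s = idm _.
Proof.
have /(f_equal (@top _ _ _)) /= <- := monad_unit_r (awfs_monad W) f.
by move=> e e'; congr (_ ∘ _); exact: Esq_eq.
Qed.

Lemma delta_coassoc f
    (s : Square (MkArr (ffl W f)) (MkArr (ffl W (MkArr (ffl W f))))) :
  top s = idm _ -> bot s = deltac f ->
  deltac (MkArr (ffl W f)) ∘ deltac f = fmap W s ∘ deltac f.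
Proof.
have /(f_equal (@bot _ _ _)) /= -> := comonad_coassoc (awfs_comonad W) f.
by move=> e e'; congr (_ ∘ _); apply: Esq_eq; rewrite ?delta_top.
Qed.

Lemma mu_assoc f
    (s : Square (MkArr (ffr W (MkArr (ffr W f)))) (MkArr (ffr W f))) :
  top s = muc f -> bot s = idm _ ->
  muc f ∘ muc (MkArr (ffr W f)) = muc f ∘ fmap W s.
Proof.
have /(f_equal (@top _ _ _)) /= -> := monad_assoc (awfs_monad W) f.
by move=> e e'; congr (_ ∘ _); apply: Esq_eq; rewrite ?mu_bot.
Qed.

Lemma delta_nat (f g : Arr M) (s : Square f g) :
  deltac g ∘ fmap W s = fmap W (ffL_map W s) ∘ deltac f.
Proof. by have /(f_equal (@bot _ _ _)) := nt_nat (awfs_delta W) s. Qed.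

Lemma mu_nat (f g : Arr M) (s : Square f g) :
  muc g ∘ fmap W (ffR_map W s) = fmap W s ∘ muc f.
Proof. by have /(f_equal (@top _ _ _)) := nt_nat (awfs_mu W) s. Qed.

Lemma delta_mu f
    (s : Square (MkArr (ffl W (MkArr (ffr W f))))
                (MkArr (ffr W (MkArr (ffl W f))))) :
  top s = deltac f -> bot s = muc f ->
  deltac f ∘ muc f
  = muc (MkArr (ffl W f)) ∘ fmap W s ∘ deltac (MkArr (ffr W f)).
Proof.
have [lam [comps dist]] := awfs_dist W.
move=> e e'.
have /(f_equal (@bot _ _ _)) /= := dist_comult dist f.
rewrite (comps f).2 (comps (MkArr (ffl W f))).2 => E1.
have /(f_equal (@top _ _ _)) /= := dist_mult dist f.
move=> _; rewrite /deltac /muc E1; congr (_ ∘ _ ∘ _).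
by apply: Esq_eq; rewrite ?(comps f).1 ?(comps f).2.
Qed.

Lemma awfs_wfsP : IsWFS awfs_left awfs_right.
Proof.
have LR A B (f : Hom A B) C D (g : Hom C D) :
    awfs_left f -> awfs_right g -> lifts f g.
  move=> [s [s1 s2]] [p [p1 p2]] u v e.
  pose q := @MkSquare M (MkArr f) (MkArr g) u v e.
  exists (p ∘ fmap W q ∘ s); split.
    rewrite -comp_assoc s1 -comp_assoc (ffl_nat W q) comp_assoc p1.
    by rewrite comp_idl.
  rewrite !comp_assoc p2 (ffr_nat W q) -comp_assoc.
  by rewrite s2 comp_idr.
split.
- move=> A B f; exists (W (MkArr f)), (ffl W (MkArr f)), (ffr W (MkArr f)).
  split; [|split].
  + by exists (deltac (MkArr f)); split; [exact: (deltaL (MkArr f)) | exact: (deltaR (MkArr f))].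
  + by exists (muc (MkArr f)); split; [exact: (muL (MkArr f)) | exact: (muR (MkArr f))].
  + exact: (ff_fact W (MkArr f)).
- move=> A B f; split=> [Lf C D g Rg|H]; first exact: LR.
  have Rf : awfs_right (ffr W (MkArr f)).
    by exists (muc (MkArr f)); split; [exact: (muL (MkArr f)) | exact: (muR (MkArr f))].
  have [|d [d1 d2]] := H _ _ _ Rf (ffl W (MkArr f)) (idm B).
    by rewrite (ff_fact W (MkArr f)) comp_idl.
  by exists d.
- move=> A B f; split=> [Rf C D g Lg|H]; first exact: LR.
  have Lf : awfs_left (ffl W (MkArr f)).
    by exists (deltac (MkArr f)); split; [exact: (deltaL (MkArr f)) | exact: (deltaR (MkArr f))].
  have [|d [d1 d2]] := H _ _ _ Lf (idm A) (ffr W (MkArr f)).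
    by rewrite (ff_fact W (MkArr f)) comp_idr.
  by exists d.
Qed.

Definition underlying_wfs : WFS M := MkWFS awfs_wfsP.

End AWFS.

(* A category presented by one type of objects and one type of all arrows,
   with composition (in diagrammatic order) defined on the pairs [f], [g] such
   that [tgt f = src g].  Functors between such categories can be compared for
   strict equality without transport, as required by internal categories in CAT
   and by their pullbacks. *)
Record CatOn (O A : Type) := MkCatOn {
  src : A -> O;
  tgt : A -> O;
  idn : O -> A;
  cmp : forall f g : A, tgt f = src g -> A;
  src_idn : forall x, src (idn x) = x;
  tgt_idn : forall x, tgt (idn x) = x;
  src_cmp : forall f g e, src (@cmp f g e) = src f;
  tgt_cmp : forall f g e, tgt (@cmp f g e) = tgt g;
  cmp_idl : forall f e, @cmp (idn (src f)) f e = f;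
  cmp_idr : forall f e, @cmp f (idn (tgt f)) e = f;
  cmp_assoc : forall f g h e1 e2 e3 e4,
    @cmp (@cmp f g e1) h e2 = @cmp f (@cmp g h e3) e4 }.

Arguments cmp {O A} c f g e.

Record IsFunctor (O A O' A' : Type) (C : CatOn O A) (D : CatOn O' A')
    (fo : O -> O') (fa : A -> A') : Prop := MkIsFunctor {
  fun_src : forall f, src D (fa f) = fo (src C f);
  fun_tgt : forall f, tgt D (fa f) = fo (tgt C f);
  fun_idn : forall x, fa (idn C x) = idn D (fo x);
  fun_cmp : forall f g e e', fa (cmp C f g e) = cmp D (fa f) (fa g) e' }.

(* An internal category in CAT: the category of objects is [hobj] (objects and
   horizontal arrows), the category of arrows is [hver] (vertical arrows and
   squares, composed horizontally); [vobj] and [vhor] give the action on objects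
   and on arrows of the internal source, target, identity and composition
   functors (so they compose vertical arrows and squares vertically). *)
Record DoubleCategory := MkDoubleCategory {
  DOb : Type;
  DHor : Type;
  DVer : Type;
  DSq : Type;
  hobj : CatOn DOb DHor;
  hver : CatOn DVer DSq;
  vobj : CatOn DOb DVer;
  vhor : CatOn DHor DSq;
  dsrc_functor : IsFunctor hver hobj (src vobj) (src vhor);
  dtgt_functor : IsFunctor hver hobj (tgt vobj) (tgt vhor);
  didn_functor : IsFunctor hobj hver (idn vobj) (idn vhor);
  dcmp_src : forall a b e e',
    src hver (cmp vhor a b e) = cmp vobj (src hver a) (src hver b) e';
  dcmp_tgt : forall a b e e',
    tgt hver (cmp vhor a b e) = cmp vobj (tgt hver a) (tgt hver b) e';
  dcmp_idn : forall v w e e',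
    cmp vhor (idn hver v) (idn hver w) e' = idn hver (cmp vobj v w e);
  dcmp_cmp : forall a b c d e1 e2 e3 e4 e5 e6,
    cmp vhor (cmp hver a b e1) (cmp hver c d e2) e3
    = cmp hver (cmp vhor a c e4) (cmp vhor b d e5) e6 }.

Record DoubleFunctor (D E : DoubleCategory) := MkDoubleFunctor {
  dfO : DOb D -> DOb E;
  dfH : DHor D -> DHor E;
  dfV : DVer D -> DVer E;
  dfS : DSq D -> DSq E;
  df_hobj : IsFunctor (hobj D) (hobj E) dfO dfH;
  df_hver : IsFunctor (hver D) (hver E) dfV dfS;
  df_vobj : IsFunctor (vobj D) (vobj E) dfO dfV;
  df_vhor : IsFunctor (vhor D) (vhor E) dfH dfS }.

Record df_eq (D E : DoubleCategory) (F G : DoubleFunctor D E) : Prop := {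
  df_eqO : forall x, dfO F x = dfO G x;
  df_eqH : forall x, dfH F x = dfH G x;
  df_eqV : forall x, dfV F x = dfV G x;
  df_eqS : forall x, dfS F x = dfS G x }.

Lemma is_functor_comp (O1 A1 O2 A2 O3 A3 : Type) (C1 : CatOn O1 A1)
    (C2 : CatOn O2 A2) (C3 : CatOn O3 A3) go ga fo fa :
  IsFunctor C2 C3 go ga -> IsFunctor C1 C2 fo fa ->
  IsFunctor C1 C3 (fun x => go (fo x)) (fun x => ga (fa x)).
Proof.
move=> [gs gt gi gc] [fs ft fi fc]; split=> [f|f|x|f g e e'].
- by rewrite gs fs.
- by rewrite gt ft.
- by rewrite fi gi.
- have e2 : tgt C2 (fa f) = src C2 (fa g) by rewrite ft fs e.
  by rewrite (fc _ _ _ e2).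
Qed.

Definition df_comp (D E F : DoubleCategory) (Q : DoubleFunctor E F)
    (P : DoubleFunctor D E) : DoubleFunctor D F :=
  @MkDoubleFunctor D F (fun x => dfO Q (dfO P x)) (fun x => dfH Q (dfH P x))
    (fun x => dfV Q (dfV P x)) (fun x => dfS Q (dfS P x))
    (is_functor_comp (df_hobj Q) (df_hobj P))
    (is_functor_comp (df_hver Q) (df_hver P))
    (is_functor_comp (df_vobj Q) (df_vobj P))
    (is_functor_comp (df_vhor Q) (df_vhor P)).

(* The commuting square [F ∘ P = G ∘ Q] is a pullback of double categories. *)
Definition is_pullback (D A B C : DoubleCategory)
    (P : DoubleFunctor D A) (Q : DoubleFunctor D B)
    (F : DoubleFunctor A C) (G : DoubleFunctor B C) : Prop :=
  df_eq (df_comp F P) (df_comp G Q) /\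
  forall (T : DoubleCategory) (X : DoubleFunctor T A) (Y : DoubleFunctor T B),
    df_eq (df_comp F X) (df_comp G Y) ->
    exists Z : DoubleFunctor T D,
      (df_eq (df_comp P Z) X /\ df_eq (df_comp Q Z) Y) /\
      forall Z' : DoubleFunctor T D,
        df_eq (df_comp P Z') X -> df_eq (df_comp Q Z') Y -> df_eq Z' Z.

(* In the double categories used here a square is determined by its boundary;
   [P l r t b] says that the left and right vertical arrows [l], [r] and the top
   and bottom horizontal arrows [t], [b] bound a square. *)
Record FlatSq (H V : Type) (P : V -> V -> H -> H -> Prop) := MkFlatSq {
  fs_left : V;
  fs_right : V;
  fs_top : H;
  fs_bot : H;
  fs_prop : P fs_left fs_right fs_top fs_bot }.

Lemma flat_eq (H V : Type) (P : V -> V -> H -> H -> Prop) (a b : FlatSq P) :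
  fs_left a = fs_left b -> fs_right a = fs_right b ->
  fs_top a = fs_top b -> fs_bot a = fs_bot b -> a = b.
Proof.
case: a b => [l r t m p] [l' r' t' m' p'] /= e1 e2 e3 e4; subst.
by rewrite (proof_irrelevance _ p p').
Qed.

Section Flat.
Variables (O H V : Type) (hc : CatOn O H) (vc : CatOn O V).
Variable P : V -> V -> H -> H -> Prop.

Record FlatAxioms : Prop := MkFlatAxioms {
  fl_tl : forall l r t b, P l r t b -> src hc t = src vc l;
  fl_tr : forall l r t b, P l r t b -> tgt hc t = src vc r;
  fl_bl : forall l r t b, P l r t b -> src hc b = tgt vc l;
  fl_br : forall l r t b, P l r t b -> tgt hc b = tgt vc r;
  fl_idh : forall v, P v v (idn hc (src vc v)) (idn hc (tgt vc v));
  fl_idv : forall h, P (idn vc (src hc h)) (idn vc (tgt hc h)) h h;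
  fl_cmph : forall l m r t b t' b' e e', P l m t b -> P m r t' b' ->
    P l r (cmp hc t t' e) (cmp hc b b' e');
  fl_cmpv : forall l r l' r' t m b e e', P l r t m -> P l' r' m b ->
    P (cmp vc l l' e) (cmp vc r r' e') t b }.

Hypothesis ax : FlatAxioms.

Definition flat_idh (v : V) : FlatSq P := MkFlatSq (fl_idh ax v).
Definition flat_idv (h : H) : FlatSq P := MkFlatSq (fl_idv ax h).

Lemma flat_cmph_t (a b : FlatSq P) :
  fs_right a = fs_left b -> tgt hc (fs_top a) = src hc (fs_top b).
Proof.
by move=> e; rewrite (fl_tr ax (fs_prop a)) (fl_tl ax (fs_prop b)) e.
Qed.

Lemma flat_cmph_b (a b : FlatSq P) :
  fs_right a = fs_left b -> tgt hc (fs_bot a) = src hc (fs_bot b).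
Proof.
by move=> e; rewrite (fl_br ax (fs_prop a)) (fl_bl ax (fs_prop b)) e.
Qed.

Lemma flat_cmpv_l (a b : FlatSq P) :
  fs_bot a = fs_top b -> tgt vc (fs_left a) = src vc (fs_left b).
Proof.
by move=> e; rewrite -(fl_bl ax (fs_prop a)) -(fl_tl ax (fs_prop b)) e.
Qed.

Lemma flat_cmpv_r (a b : FlatSq P) :
  fs_bot a = fs_top b -> tgt vc (fs_right a) = src vc (fs_right b).
Proof.
by move=> e; rewrite -(fl_br ax (fs_prop a)) -(fl_tr ax (fs_prop b)) e.
Qed.

Lemma flat_cmphP (a b : FlatSq P) (e : fs_right a = fs_left b) :
  P (fs_left a) (fs_right b) (cmp hc _ _ (flat_cmph_t e))
    (cmp hc _ _ (flat_cmph_b e)).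
Proof.
by apply: (fl_cmph ax _ _ (fs_prop a)); rewrite e; exact: fs_prop.
Qed.

Lemma flat_cmpvP (a b : FlatSq P) (e : fs_bot a = fs_top b) :
  P (cmp vc _ _ (flat_cmpv_l e)) (cmp vc _ _ (flat_cmpv_r e))
    (fs_top a) (fs_bot b).
Proof.
by apply: (fl_cmpv ax _ _ (fs_prop a)); rewrite e; exact: fs_prop.
Qed.

Definition flat_cmph a b e : FlatSq P := MkFlatSq (@flat_cmphP a b e).
Definition flat_cmpv a b e : FlatSq P := MkFlatSq (@flat_cmpvP a b e).

Program Definition flat_hver : CatOn V (FlatSq P) :=
  @MkCatOn V (FlatSq P) (@fs_left H V P) (@fs_right H V P) flat_idh flat_cmph
    _ _ _ _ _ _ _.
Next Obligation. by []. Qed.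
Next Obligation. by []. Qed.
Next Obligation. by []. Qed.
Next Obligation. by []. Qed.
Next Obligation.
apply: flat_eq => //=.
- move: (flat_cmph_t _) => /=; rewrite -(fl_tl ax (fs_prop f)) => e'.
  exact: cmp_idl.
- move: (flat_cmph_b _) => /=; rewrite -(fl_bl ax (fs_prop f)) => e'.
  exact: cmp_idl.
Qed.
Next Obligation.
apply: flat_eq => //=.
- move: (flat_cmph_t _) => /=; rewrite -(fl_tr ax (fs_prop f)) => e'.
  exact: cmp_idr.
- move: (flat_cmph_b _) => /=; rewrite -(fl_br ax (fs_prop f)) => e'.
  exact: cmp_idr.
Qed.
Next Obligation. by apply: flat_eq => //=; exact: cmp_assoc. Qed.

Program Definition flat_vhor : CatOn H (FlatSq P) :=
  @MkCatOn H (FlatSq P) (@fs_top H V P) (@fs_bot H V P) flat_idv flat_cmpv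
    _ _ _ _ _ _ _.
Next Obligation. by []. Qed.
Next Obligation. by []. Qed.
Next Obligation. by []. Qed.
Next Obligation. by []. Qed.
Next Obligation.
apply: flat_eq => //=.
- move: (flat_cmpv_l _) => /=; rewrite (fl_tl ax (fs_prop f)) => e'.
  exact: cmp_idl.
- move: (flat_cmpv_r _) => /=; rewrite (fl_tr ax (fs_prop f)) => e'.
  exact: cmp_idl.
Qed.
Next Obligation.
apply: flat_eq => //=.
- move: (flat_cmpv_l _) => /=; rewrite (fl_bl ax (fs_prop f)) => e'.
  exact: cmp_idr.
- move: (flat_cmpv_r _) => /=; rewrite (fl_br ax (fs_prop f)) => e'.
  exact: cmp_idr.
Qed.
Next Obligation. by apply: flat_eq => //=; exact: cmp_assoc. Qed.

Lemma cmp_irr (O' A' : Type) (C : CatOn O' A') f g e e' :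
  cmp C f g e = cmp C f g e'.
Proof. by rewrite (proof_irrelevance _ e e'). Qed.

Program Definition Flat : DoubleCategory :=
  @MkDoubleCategory O H V (FlatSq P) hc flat_hver vc flat_vhor
    _ _ _ _ _ _ _.
Next Obligation.
split=> //= [a|a|a b e e'].
- exact: (fl_tl ax (fs_prop a)).
- exact: (fl_tr ax (fs_prop a)).
- exact: cmp_irr.
Qed.
Next Obligation.
split=> //= [a|a|a b e e'].
- exact: (fl_bl ax (fs_prop a)).
- exact: (fl_br ax (fs_prop a)).
- exact: cmp_irr.
Qed.
Next Obligation.
split=> //= [x|f g e e'].
  by apply: flat_eq; rewrite //= ?src_idn ?tgt_idn.
apply: flat_eq; rewrite /= ?src_cmp ?tgt_cmp //; exact: cmp_irr.
Qed.
Next Obligation. exact: cmp_irr. Qed.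
Next Obligation. exact: cmp_irr. Qed.
Next Obligation.
by apply: flat_eq; rewrite /= ?src_cmp ?tgt_cmp //; exact: cmp_irr.
Qed.
Next Obligation. by apply: flat_eq => //=; exact: cmp_irr. Qed.

End Flat.

Section FlatFunctor.
Variables (O H V : Type) (hc : CatOn O H) (vc : CatOn O V).
Variables (P : V -> V -> H -> H -> Prop) (ax : FlatAxioms hc vc P).
Variables (O' H' V' : Type) (hc' : CatOn O' H') (vc' : CatOn O' V').
Variables (P' : V' -> V' -> H' -> H' -> Prop) (ax' : FlatAxioms hc' vc' P').
Variables (fO : O -> O') (fH : H -> H') (fV : V -> V').
Hypothesis fh : IsFunctor hc hc' fO fH.
Hypothesis fv : IsFunctor vc vc' fO fV.
Hypothesis fP : forall l r t b, P l r t b -> P' (fV l) (fV r) (fH t) (fH b).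

Definition flat_fS (a : FlatSq P) : FlatSq P' := MkFlatSq (fP (fs_prop a)).

Program Definition FlatFunctor : DoubleFunctor (Flat ax) (Flat ax') :=
  @MkDoubleFunctor (Flat ax) (Flat ax') fO fH fV flat_fS fh _ fv _.
Next Obligation.
split=> //= [v|a b e e'].
  by apply: flat_eq; rewrite //= (fun_idn fh) ?(fun_src fv) ?(fun_tgt fv).
by apply: flat_eq => //=; exact: (fun_cmp fh).
Qed.
Next Obligation.
split=> //= [v|a b e e'].
  by apply: flat_eq; rewrite //= (fun_idn fv) ?(fun_src fh) ?(fun_tgt fh).
by apply: flat_eq => //=; exact: (fun_cmp fv).
Qed.

End FlatFunctor.

Section Sq.
Variable M : Category.

Definition castc (A B B' : M) (e : B = B') (f : Hom A B) : Hom A B' :=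
  eq_rect B (fun X => Hom A X) f B' e.

Definition acomp (f g : Arr M) (e : cod f = dom g) : Arr M :=
  MkArr (arr g ∘ castc e (arr f)).

Program Definition arr_cat : CatOn M (Arr M) :=
  @MkCatOn M (Arr M) (@dom M) (@cod M) (fun A => MkArr (idm A)) acomp
    _ _ _ _ _ _ _.
Next Obligation. by []. Qed.
Next Obligation. by []. Qed.
Next Obligation. by []. Qed.
Next Obligation. by []. Qed.
Next Obligation.
by rewrite (proof_irrelevance _ e erefl) /acomp /= comp_idr.
Qed.
Next Obligation.
by rewrite (proof_irrelevance _ e erefl) /acomp /= comp_idl.
Qed.
Next Obligation.
case: f g h e1 e2 e3 e4 => [A B f] [B' C g] [C' D h] /= e1 e2 e3 e4; subst.
rewrite (proof_irrelevance _ e3 erefl) (proof_irrelevance _ e4 erefl).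
by rewrite /acomp /= comp_assoc.
Qed.

Lemma MkArr_inj (A B : M) (f g : Hom A B) : MkArr f = MkArr g -> f = g.
Proof.
move=> e.
have H : forall x : Arr M, MkArr f = x -> forall (p : A = dom x) (q : B = cod x),
    arr x = eq_rect A (fun X => Hom X (cod x)) (castc q f) _ p.
  move=> x <- /= p q.
  by rewrite (proof_irrelevance _ p erefl) (proof_irrelevance _ q erefl).
by have := H _ e erefl erefl.
Qed.

Definition commutes (l r t b : Arr M) : Prop :=
  exists s : Square l r, t = MkArr (top s) /\ b = MkArr (bot s).

Lemma commutes_flat : FlatAxioms arr_cat arr_cat commutes.
Proof.
split=> /=; try by move=> l r t b [s [? ?]]; subst.
- by move=> v; exists (sq_id v).
- move=> h; have s : idm (cod h) ∘ arr h = arr h ∘ idm (dom h).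
    by rewrite comp_idl comp_idr.
  by exists (@MkSquare M (MkArr (idm (dom h))) (MkArr (idm (cod h)))
               (arr h) (arr h) s).
- move=> l m r t b t' b' e e' [s [? ?]] [s' [? ?]]; subst.
  exists (sq_hcomp s' s); rewrite /acomp.
  by rewrite (proof_irrelevance _ e erefl) (proof_irrelevance _ e' erefl).
- move=> [A B f] [A' B' f'] [C D g] [C' D' g'] t m b /= e e'; subst.
  move=> [[h k /= H] [/= -> ->]] [[h' k' /= H'] [/= /MkArr_inj E ->]]; subst h'.
  have S : g' ∘ f' ∘ h = k' ∘ (g ∘ f).
    by rewrite -comp_assoc H !comp_assoc H'.
  by exists (@MkSquare M (MkArr (g ∘ f)) (MkArr (g' ∘ f')) h k' S).
Qed.

Definition SqDouble : DoubleCategory := Flat commutes_flat.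

End Sq.

Section SqFunctor.
Variables (K M : Category) (V : Functor K M).

Lemma arr_map_functor : IsFunctor (arr_cat K) (arr_cat M) V (arr_map V).
Proof.
split=> //= [A|[A B f] [B' C g] /= e e'].
  by rewrite /arr_map /= fmap_id.
subst; rewrite (proof_irrelevance _ e' erefl) /arr_map /acomp /=.
by rewrite fmap_comp.
Qed.

Lemma arr_map_commutes (l r t b : Arr K) : commutes l r t b ->
  commutes (arr_map V l) (arr_map V r) (arr_map V t) (arr_map V b).
Proof.
move=> [s [-> ->]].
have S : fmap V (arr r) ∘ fmap V (top s) = fmap V (bot s) ∘ fmap V (arr l).
  by rewrite -!fmap_comp sq_comm.
by exists (@MkSquare M (arr_map V l) (arr_map V r) (fmap V (top s))
  (fmap V (bot s)) S).
Qed.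

Definition SqFunctor : DoubleFunctor (SqDouble K) (SqDouble M) :=
  FlatFunctor _ _ arr_map_functor arr_map_functor arr_map_commutes.

End SqFunctor.

Section CoAlg.
Variables (M : Category) (W : AWFS M).

Lemma coalg_comm (f : Arr M) (s : Hom (cod f) (W f)) :
  s ∘ arr f = ffl W f -> ffl W f ∘ idm (dom f) = s ∘ arr f.
Proof. by rewrite comp_idr. Qed.

Lemma alg_comm (f : Arr M) (p : Hom (W f) (dom f)) :
  arr f ∘ p = ffr W f -> arr f ∘ p = idm (cod f) ∘ ffr W f.
Proof. by rewrite comp_idl. Qed.

(* Coalgebras [(idm, s) : f -> L f] for the comonad L. *)
Record Coalgebra (f : Arr M) := MkCoalgebra {
  co_str : Hom (cod f) (W f);
  co_left : co_str ∘ arr f = ffl W f;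
  co_counit : ffr W f ∘ co_str = idm (cod f);
  co_coassoc : deltac W f ∘ co_str
    = @Esq M W f (MkArr (ffl W f)) (idm (dom f)) co_str (coalg_comm co_left)
      ∘ co_str }.

(* Algebras [(p, idm) : R f -> f] for the monad R. *)
Record Algebra (f : Arr M) := MkAlgebra {
  al_str : Hom (W f) (dom f);
  al_unit : al_str ∘ ffl W f = idm (dom f);
  al_right : arr f ∘ al_str = ffr W f;
  al_assoc : al_str ∘ muc W f
    = al_str ∘ @Esq M W (MkArr (ffr W f)) f al_str (idm (cod f))
                 (alg_comm al_right) }.

Lemma coalgebra_eq f (s t : Coalgebra f) : co_str s = co_str t -> s = t.
Proof.
case: s t => [s a b c] [t a' b' c'] /= e; subst t.
rewrite -(proof_irrelevance _ a a') in c' *.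
by rewrite (proof_irrelevance _ b b') (proof_irrelevance _ c c').
Qed.

Lemma algebra_eq f (p q : Algebra f) : al_str p = al_str q -> p = q.
Proof.
case: p q => [s a b c] [t a' b' c'] /= e; subst t.
rewrite -(proof_irrelevance _ b b') in c' *.
by rewrite (proof_irrelevance _ a a') (proof_irrelevance _ c c').
Qed.

Lemma co_coassocE f (s : Coalgebra f) (u : Square f (MkArr (ffl W f))) :
  top u = idm _ -> bot u = co_str s ->
  deltac W f ∘ co_str s = fmap W u ∘ co_str s.
Proof. by move=> e e'; rewrite co_coassoc; congr (_ ∘ _); exact: Esq_eq. Qed.

Lemma al_assocE f (p : Algebra f) (u : Square (MkArr (ffr W f)) f) :
  top u = al_str p -> bot u = idm _ ->
  al_str p ∘ muc W f = al_str p ∘ fmap W u.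
Proof. by move=> e e'; rewrite al_assoc; congr (_ ∘ _); exact: Esq_eq. Qed.

Definition free_alg (f : Arr M) : Algebra (MkArr (ffr W f)) :=
  @MkAlgebra (MkArr (ffr W f)) (muc W f) (muL W f) (muR W f)
    (@mu_assoc M W f (@MkSquare M (MkArr (ffr W (MkArr (ffr W f))))
      (MkArr (ffr W f)) _ _ (@alg_comm (MkArr (ffr W f)) _ (muR W f))) erefl erefl).

Definition cofree_coalg (f : Arr M) : Coalgebra (MkArr (ffl W f)) :=
  @MkCoalgebra (MkArr (ffl W f)) (deltac W f) (deltaL W f) (deltaR W f)
    (@delta_coassoc M W f (@MkSquare M (MkArr (ffl W f))
      (MkArr (ffl W (MkArr (ffl W f)))) _ _ (@coalg_comm (MkArr (ffl W f)) _ (deltaL W f)))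
      erefl erefl).

Lemma phi_top f r (p : Hom (W r) (dom r)) (s : Hom (cod f) (W f))
    (u : Square f r) :
  s ∘ arr f = ffl W f -> p ∘ ffl W r = idm _ ->
  p ∘ fmap W u ∘ s ∘ arr f = top u.
Proof.
move=> es ep; rewrite -(comp_assoc _ s) es -comp_assoc (ffl_nat W u).
by rewrite comp_assoc ep comp_idl.
Qed.

Lemma phi_bot f r (p : Hom (W r) (dom r)) (s : Hom (cod f) (W f))
    (u : Square f r) :
  ffr W f ∘ s = idm _ -> arr r ∘ p = ffr W r ->
  arr r ∘ (p ∘ fmap W u ∘ s) = bot u.
Proof.
move=> es ep; rewrite !comp_assoc ep (ffr_nat W u) -comp_assoc es.
by rewrite comp_idr.
Qed.

Lemma alg_step x r (p : Algebra r) (u : Square x r)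
    (v : Square (MkArr (ffr W x)) r) :
  top v = al_str p ∘ fmap W u -> bot v = bot u ->
  al_str p ∘ fmap W u ∘ muc W x = al_str p ∘ fmap W v.
Proof.
move=> e e'.
rewrite -comp_assoc -mu_nat comp_assoc (al_assoc p) -comp_assoc E_comp.
by congr (_ ∘ _); apply: Esq_eq; rewrite /= ?e ?e' ?comp_idl.
Qed.

Lemma coalg_step x f (s : Coalgebra f) (u : Square f x)
    (v : Square f (MkArr (ffl W x))) :
  top v = top u -> bot v = fmap W u ∘ co_str s ->
  deltac W x ∘ (fmap W u ∘ co_str s) = fmap W v ∘ co_str s.
Proof.
move=> e e'.
rewrite comp_assoc delta_nat -comp_assoc (co_coassoc s) comp_assoc E_comp.
by congr (_ ∘ _); apply: Esq_eq; rewrite /= ?e ?e' ?comp_idr.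
Qed.

Lemma dist_coalg f r (s : Coalgebra f) (u : Square f (MkArr (ffr W r)))
    (v : Square f (MkArr (ffr W (MkArr (ffl W r))))) :
  top v = deltac W r ∘ top u -> bot v = muc W r ∘ fmap W u ∘ co_str s ->
  deltac W r ∘ (muc W r ∘ fmap W u ∘ co_str s)
  = muc W (MkArr (ffl W r)) ∘ fmap W v ∘ co_str s.
Proof.
move=> e e'.
have H : ffr W (MkArr (ffl W r)) ∘ deltac W r
         = muc W r ∘ ffl W (MkArr (ffr W r)) by rewrite deltaR muL.
have H1 : ffl W (MkArr (ffr W r)) ∘ top u = fmap W u ∘ co_str s ∘ arr f.
  by rewrite -comp_assoc (co_left s) (ffl_nat W u).
rewrite -(comp_assoc _ _ (co_str s)) comp_assoc.
rewrite (@delta_mu M W r (@MkSquare M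
  (MkArr (ffl W (MkArr (ffr W r)))) (MkArr (ffr W (MkArr (ffl W r))))
  (deltac W r) (muc W r) H)) // -comp_assoc.
rewrite (@coalg_step _ _ s u (@MkSquare M f
  (MkArr (ffl W (MkArr (ffr W r)))) (top u) (fmap W u ∘ co_str s) H1)) //.
rewrite comp_assoc -(comp_assoc _ _ (fmap W _)) E_comp.
congr (_ ∘ _ ∘ _); apply: Esq_eq => /=; first by rewrite e.
by rewrite e' comp_assoc.
Qed.

Lemma dist_alg x f (p : Algebra f) (u : Square (MkArr (ffl W x)) f)
    (v : Square (MkArr (ffl W (MkArr (ffr W x)))) f) :
  top v = al_str p ∘ fmap W u ∘ deltac W x -> bot v = bot u ∘ muc W x ->
  al_str p ∘ fmap W u ∘ deltac W x ∘ muc W x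
  = al_str p ∘ fmap W v ∘ deltac W (MkArr (ffr W x)).
Proof.
move=> e e'.
have H : ffr W (MkArr (ffl W x)) ∘ deltac W x
         = muc W x ∘ ffl W (MkArr (ffr W x)) by rewrite deltaR muL.
have H1 : arr f ∘ (al_str p ∘ fmap W u) = bot u ∘ ffr W (MkArr (ffl W x)).
  by rewrite comp_assoc (al_right p) (ffr_nat W u).
rewrite -(comp_assoc _ (deltac W x)).
rewrite (@delta_mu M W x (@MkSquare M
  (MkArr (ffl W (MkArr (ffr W x)))) (MkArr (ffr W (MkArr (ffl W x))))
  (deltac W x) (muc W x) H)) // !comp_assoc.
rewrite (@alg_step _ _ p u (@MkSquare M (MkArr (ffr W (MkArr (ffl W x)))) f
  (al_str p ∘ fmap W u) (bot u) H1)) //.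
rewrite -(comp_assoc (al_str p)) E_comp.
by congr (_ ∘ _ ∘ _); apply: Esq_eq; rewrite /= ?e ?e'.
Qed.

Section CoComp.
Variables (A B C : M) (f : Hom A B) (g : Hom B C).
Variables (s : Coalgebra (MkArr f)) (t : Coalgebra (MkArr g)).

Let gf := MkArr (g ∘ f).
Let Rgf := MkArr (ffr W gf).

Lemma co_w_comm : ffr W gf ∘ ffl W gf = g ∘ f.
Proof. exact: (ff_fact W gf). Qed.

Definition co_w : Hom B (W gf) :=
  muc W gf ∘ @Esq M W (MkArr f) Rgf (ffl W gf) g co_w_comm ∘ co_str s.

Lemma co_w_bot : ffr W gf ∘ co_w = idm C ∘ g.
Proof.
rewrite comp_idl; apply: (@phi_bot (MkArr f) Rgf) (muR W gf).
exact: co_counit.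
Qed.

Lemma co_w_top : co_w ∘ f = ffl W gf.
Proof. by apply: (@phi_top (MkArr f) Rgf) (muL W gf); exact: co_left. Qed.

(* [co_w] lifts [L (g ∘ f)] along [(f, s)] against the free algebra on [g ∘ f];
   the composite then lifts [co_w] along [(g, t)]. *)
Definition co_cmp_str : Hom C (W gf) :=
  muc W gf ∘ @Esq M W (MkArr g) Rgf co_w (idm C) co_w_bot ∘ co_str t.

Lemma co_cmp_top : co_cmp_str ∘ g = co_w.
Proof. by apply: (@phi_top (MkArr g) Rgf) (muL W gf); exact: co_left. Qed.

Lemma co_cmp_left : co_cmp_str ∘ arr gf = ffl W gf.
Proof. by rewrite /= comp_assoc co_cmp_top co_w_top. Qed.

Lemma co_cmp_counit : ffr W gf ∘ co_cmp_str = idm C.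
Proof. apply: (@phi_bot (MkArr g) Rgf) (muR W gf); exact: co_counit. Qed.

Lemma co_cmp_phi r (p : Algebra r) (u : Square gf r)
    (u1 : Square (MkArr f) r) (u2 : Square (MkArr g) r) :
  top u1 = top u -> bot u1 = bot u ∘ g ->
  top u2 = al_str p ∘ fmap W u1 ∘ co_str s -> bot u2 = bot u ->
  al_str p ∘ fmap W u ∘ co_cmp_str = al_str p ∘ fmap W u2 ∘ co_str t.
Proof.
move=> e1 e2 e3 e4.
have H : arr r ∘ (al_str p ∘ fmap W u) = bot u ∘ ffr W gf.
  by rewrite comp_assoc (al_right p) (ffr_nat W u).
pose v := @MkSquare M Rgf r (al_str p ∘ fmap W u) (bot u) H.
have step := @alg_step gf r p u v erefl erefl.
rewrite /co_cmp_str !comp_assoc step -(comp_assoc (al_str p)) E_comp.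
congr (_ ∘ _ ∘ _); apply: Esq_eq => /=; last by rewrite comp_idr e4.
rewrite e3 /co_w !comp_assoc step -(comp_assoc (al_str p)) E_comp.
congr (_ ∘ _ ∘ _); apply: Esq_eq => //=.
by rewrite -comp_assoc (ffl_nat W u) comp_assoc (al_unit p) comp_idl e1.
Qed.

Lemma co_cmp_phi_ex r (p : Algebra r) (u : Square gf r) :
  exists (u1 : Square (MkArr f) r) (u2 : Square (MkArr g) r),
    (top u1 = top u /\ bot u1 = bot u ∘ g) /\
    (top u2 = al_str p ∘ fmap W u1 ∘ co_str s /\ bot u2 = bot u) /\
    al_str p ∘ fmap W u ∘ co_cmp_str = al_str p ∘ fmap W u2 ∘ co_str t.
Proof.
have H1 : arr r ∘ top u = bot u ∘ g ∘ f by rewrite -comp_assoc (sq_comm u).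
pose u1 := @MkSquare M (MkArr f) r (top u) (bot u ∘ g) H1.
have H2 : arr r ∘ (al_str p ∘ fmap W u1 ∘ co_str s) = bot u ∘ g.
  by apply: (@phi_bot (MkArr f) r) (al_right p); exact: co_counit.
pose u2 := @MkSquare M (MkArr g) r _ (bot u) H2.
by exists u1, u2; do 2!split=> //; exact: (@co_cmp_phi r p u u1 u2).
Qed.

Lemma co_cmp_coassoc :
  deltac W gf ∘ co_cmp_str
  = @Esq M W gf (MkArr (ffl W gf)) (idm A) co_cmp_str (coalg_comm co_cmp_left)
    ∘ co_cmp_str.
Proof.
set Lgf := MkArr (ffl W gf).
have H : ffr W Lgf ∘ ffl W Lgf = co_cmp_str ∘ (g ∘ f).
  by rewrite (ff_fact W Lgf) (co_cmp_left).
pose u := @MkSquare M gf (MkArr (ffr W Lgf)) (ffl W Lgf) co_cmp_str H.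
have H1 : ffr W Lgf ∘ ffl W Lgf = co_cmp_str ∘ g ∘ f by rewrite -comp_assoc.
pose u1 := @MkSquare M (MkArr f) (MkArr (ffr W Lgf)) (ffl W Lgf)
  (co_cmp_str ∘ g) H1.
have H2 : ffr W Lgf ∘ (muc W Lgf ∘ fmap W u1 ∘ co_str s) = co_cmp_str ∘ g.
  apply: (@phi_bot (MkArr f) (MkArr (ffr W Lgf))) (muR W Lgf).
  exact: co_counit.
pose u2 := @MkSquare M (MkArr g) (MkArr (ffr W Lgf)) _ co_cmp_str H2.
transitivity (muc W Lgf ∘ fmap W u2 ∘ co_str t).
  apply: (@dist_coalg (MkArr g) gf t
    (@MkSquare M (MkArr g) Rgf co_w (idm C) co_w_bot) u2) => //=.
  symmetry; apply: (@dist_coalg (MkArr f) gf s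
    (@MkSquare M (MkArr f) Rgf (ffl W gf) g co_w_comm) u1) => /=.
    exact: (esym (deltaL W gf)).
  exact: co_cmp_top.
rewrite -(@co_cmp_phi _ (free_alg Lgf) u u1 u2) //=; congr (_ ∘ _).
have H3 : ffr W Lgf ∘ ffl W Lgf = idm _ ∘ arr Lgf.
  by rewrite comp_idl (ff_fact W Lgf).
rewrite -[Esq _ _]comp_idl.
rewrite -(@mu_unit M W Lgf (@MkSquare M Lgf (MkArr (ffr W Lgf)) _ _ H3)) //.
rewrite -comp_assoc E_comp; congr (_ ∘ _); apply: Esq_eq => //=.
  by rewrite comp_idr.
by rewrite comp_idl.
Qed.

Definition co_cmp : Coalgebra gf :=
  @MkCoalgebra gf co_cmp_str co_cmp_left co_cmp_counit co_cmp_coassoc.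

End CoComp.

Lemma co_id_left (A : M) :
  ffl W (MkArr (idm A)) ∘ idm A = ffl W (MkArr (idm A)).
Proof. by rewrite comp_idr. Qed.

Lemma co_id_coassoc (A : M) :
  deltac W (MkArr (idm A)) ∘ ffl W (MkArr (idm A))
  = @Esq M W (MkArr (idm A)) (MkArr (ffl W (MkArr (idm A)))) (idm A)
      (ffl W (MkArr (idm A))) (@coalg_comm (MkArr (idm A)) _ (co_id_left A))
    ∘ ffl W (MkArr (idm A)).
Proof.
rewrite (deltaL W (MkArr (idm A))) (ffl_nat W (@MkSquare M (MkArr (idm A))
  (MkArr (ffl W (MkArr (idm A)))) (idm A) (ffl W (MkArr (idm A)))
  (@coalg_comm (MkArr (idm A)) _ (co_id_left A)))).
by rewrite /= comp_idr.
Qed.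

Definition co_id (A : M) : Coalgebra (MkArr (idm A)) :=
  @MkCoalgebra (MkArr (idm A)) (ffl W (MkArr (idm A))) (co_id_left A)
    (ff_fact W (MkArr (idm A))) (co_id_coassoc A).

Lemma co_id_phi (A : M) r (p : Algebra r) (u : Square (MkArr (idm A)) r) :
  al_str p ∘ fmap W u ∘ ffl W (MkArr (idm A)) = top u.
Proof.
by rewrite -comp_assoc (ffl_nat W u) comp_assoc (al_unit p) comp_idl.
Qed.

Section AlComp.
Variables (A B C : M) (f : Hom A B) (g : Hom B C).
Variables (p : Algebra (MkArr f)) (q : Algebra (MkArr g)).

Let gf := MkArr (g ∘ f).
Let Lgf := MkArr (ffl W gf).

Lemma al_v_comm : g ∘ f = ffr W gf ∘ ffl W gf.
Proof. exact: (esym (ff_fact W gf)). Qed.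

Definition al_v : Hom (W gf) B :=
  al_str q ∘ @Esq M W Lgf (MkArr g) f (ffr W gf) al_v_comm ∘ deltac W gf.

Lemma al_v_top : f ∘ idm A = al_v ∘ ffl W gf.
Proof.
rewrite comp_idr; symmetry; apply: (@phi_top Lgf (MkArr g)) (deltaL W gf) _.
exact: al_unit.
Qed.

Lemma al_v_bot : g ∘ al_v = ffr W gf.
Proof. by apply: (@phi_bot Lgf (MkArr g)) (deltaR W gf) _; exact: al_right. Qed.

Definition al_cmp_str : Hom (W gf) A :=
  al_str p ∘ @Esq M W Lgf (MkArr f) (idm A) al_v al_v_top ∘ deltac W gf.

Lemma al_cmp_bot : f ∘ al_cmp_str = al_v.
Proof. by apply: (@phi_bot Lgf (MkArr f)) (deltaR W gf) _; exact: al_right. Qed.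

Lemma al_cmp_unit : al_cmp_str ∘ ffl W gf = idm A.
Proof. apply: (@phi_top Lgf (MkArr f)) (deltaL W gf) _; exact: al_unit. Qed.

Lemma al_cmp_right : arr gf ∘ al_cmp_str = ffr W gf.
Proof. by rewrite /= -comp_assoc al_cmp_bot al_v_bot. Qed.

Lemma al_cmp_phi x (s : Coalgebra x) (u : Square x gf)
    (u1 : Square x (MkArr g)) (u2 : Square x (MkArr f)) :
  top u1 = f ∘ top u -> bot u1 = bot u ->
  top u2 = top u -> bot u2 = al_str q ∘ fmap W u1 ∘ co_str s ->
  al_cmp_str ∘ fmap W u ∘ co_str s = al_str p ∘ fmap W u2 ∘ co_str s.
Proof.
move=> e1 e2 e3 e4.
have H : ffl W gf ∘ top u = fmap W u ∘ co_str s ∘ arr x.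
  by rewrite -comp_assoc (co_left s) (ffl_nat W u).
pose v := @MkSquare M x Lgf (top u) (fmap W u ∘ co_str s) H.
have step := @coalg_step gf x s u v erefl erefl.
rewrite /al_cmp_str -!comp_assoc step (comp_assoc (Esq _ _)) E_comp.
congr (_ ∘ (_ ∘ _)); apply: Esq_eq => /=; first by rewrite comp_idl e3.
rewrite e4 /al_v -!comp_assoc step (comp_assoc (Esq _ _)) E_comp.
congr (_ ∘ (_ ∘ _)); apply: Esq_eq => //=.
by rewrite comp_assoc (ffr_nat W u) -comp_assoc (co_counit s) comp_idr e2.
Qed.

Lemma al_cmp_phi_ex x (s : Coalgebra x) (u : Square x gf) :
  exists (u1 : Square x (MkArr g)) (u2 : Square x (MkArr f)),
    (top u1 = f ∘ top u /\ bot u1 = bot u) /\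
    (top u2 = top u /\ bot u2 = al_str q ∘ fmap W u1 ∘ co_str s) /\
    al_cmp_str ∘ fmap W u ∘ co_str s = al_str p ∘ fmap W u2 ∘ co_str s.
Proof.
have H1 : g ∘ (f ∘ top u) = bot u ∘ arr x by rewrite comp_assoc (sq_comm u).
pose u1 := @MkSquare M x (MkArr g) (f ∘ top u) (bot u) H1.
have H2 : f ∘ top u = (al_str q ∘ fmap W u1 ∘ co_str s) ∘ arr x.
  by symmetry; apply: (@phi_top x (MkArr g)) (co_left s) _; exact: al_unit.
pose u2 := @MkSquare M x (MkArr f) (top u) _ H2.
by exists u1, u2; do 2!split=> //; exact: (@al_cmp_phi x s u u1 u2).
Qed.

Lemma al_cmp_assoc :
  al_cmp_str ∘ muc W gf
  = al_cmp_str ∘ @Esq M W (MkArr (ffr W gf)) gf al_cmp_str (idm C)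
                   (alg_comm al_cmp_right).
Proof.
set Rgf := MkArr (ffr W gf).
have H : g ∘ f ∘ al_cmp_str = ffr W Rgf ∘ ffl W Rgf.
  by rewrite (ff_fact W Rgf) (al_cmp_right).
pose u := @MkSquare M (MkArr (ffl W Rgf)) gf al_cmp_str (ffr W Rgf) H.
have H1 : g ∘ (f ∘ al_cmp_str) = ffr W Rgf ∘ ffl W Rgf by rewrite comp_assoc.
pose u1 := @MkSquare M (MkArr (ffl W Rgf)) (MkArr g) (f ∘ al_cmp_str)
  (ffr W Rgf) H1.
have H2 : f ∘ al_cmp_str
    = (al_str q ∘ fmap W u1 ∘ deltac W Rgf) ∘ ffl W Rgf.
  symmetry; apply: (@phi_top (MkArr (ffl W Rgf)) (MkArr g)) (deltaL W Rgf) _.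
  exact: al_unit.
pose u2 := @MkSquare M (MkArr (ffl W Rgf)) (MkArr f) al_cmp_str _ H2.
transitivity (al_str p ∘ fmap W u2 ∘ deltac W Rgf).
  apply: (@dist_alg gf (MkArr f) p
    (@MkSquare M Lgf (MkArr f) (idm A) al_v al_v_top) u2) => //=.
  symmetry; apply: (@dist_alg gf (MkArr g) q
    (@MkSquare M Lgf (MkArr g) f (ffr W gf) al_v_comm) u1) => /=.
    exact: al_cmp_bot.
  exact: (esym (muR W gf)).
rewrite -(@al_cmp_phi _ (cofree_coalg Rgf) u u1 u2) //= -comp_assoc.
congr (_ ∘ _).
have H3 : arr Rgf ∘ idm _ = ffr W Rgf ∘ ffl W Rgf.
  by rewrite comp_idr (ff_fact W Rgf).
rewrite -[RHS]comp_idr.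
rewrite -(@delta_counit M W Rgf (@MkSquare M (MkArr (ffl W Rgf)) Rgf _ _ H3)) //.
rewrite comp_assoc E_comp; congr (_ ∘ _); apply: Esq_eq => //=.
  by rewrite comp_idr.
by rewrite comp_idl.
Qed.

Definition al_cmp : Algebra gf :=
  @MkAlgebra gf al_cmp_str al_cmp_unit al_cmp_right al_cmp_assoc.

End AlComp.

Lemma al_id_right (A : M) :
  idm A ∘ ffr W (MkArr (idm A)) = ffr W (MkArr (idm A)).
Proof. by rewrite comp_idl. Qed.

Lemma al_id_assoc (A : M) :
  ffr W (MkArr (idm A)) ∘ muc W (MkArr (idm A))
  = ffr W (MkArr (idm A))
    ∘ @Esq M W (MkArr (ffr W (MkArr (idm A)))) (MkArr (idm A))
        (ffr W (MkArr (idm A))) (idm A)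
        (@alg_comm (MkArr (idm A)) _ (al_id_right A)).
Proof.
rewrite (muR W (MkArr (idm A))) (ffr_nat W (@MkSquare M
  (MkArr (ffr W (MkArr (idm A)))) (MkArr (idm A)) (ffr W (MkArr (idm A)))
  (idm A) (@alg_comm (MkArr (idm A)) _ (al_id_right A)))).
by rewrite /= comp_idl.
Qed.

Definition al_id (A : M) : Algebra (MkArr (idm A)) :=
  @MkAlgebra (MkArr (idm A)) (ffr W (MkArr (idm A)))
    (ff_fact W (MkArr (idm A))) (al_id_right A) (al_id_assoc A).

Lemma al_id_phi (A : M) x (s : Coalgebra x) (u : Square x (MkArr (idm A))) :
  ffr W (MkArr (idm A)) ∘ fmap W u ∘ co_str s = bot u.
Proof.
by rewrite (ffr_nat W u) -comp_assoc (co_counit s) comp_idr.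
Qed.

Record VCoalg := MkVCoalg { vc_arr : Arr M; vc_str : Coalgebra vc_arr }.

Definition cast_coalg (f : Arr M) (B : M) (e : cod f = B) (s : Coalgebra f) :
    Coalgebra (MkArr (castc e (arr f))) :=
  match e with erefl => s end.

Definition vcoalg_cmp (v w : VCoalg) (e : cod (vc_arr v) = dom (vc_arr w)) :
    VCoalg :=
  MkVCoalg (@co_cmp _ _ _ (castc e (arr (vc_arr v))) (arr (vc_arr w))
              (cast_coalg e (vc_str v)) (vc_str w)).

Lemma vcoalg_eq (A B : M) (f f' : Hom A B) (s : Coalgebra (MkArr f))
    (s' : Coalgebra (MkArr f')) :
  f = f' ->
  (forall u : Square (MkArr f) (MkArr (ffr W (MkArr f'))),
    top u = ffl W (MkArr f') -> bot u = idm B ->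
    muc W (MkArr f') ∘ fmap W u ∘ co_str s = co_str s') ->
  MkVCoalg s = MkVCoalg s'.
Proof.
move=> e; subst f' => H; congr MkVCoalg; apply: coalgebra_eq.
have H3 : ffr W (MkArr f) ∘ ffl W (MkArr f) = idm _ ∘ f.
  by rewrite comp_idl (ff_fact W (MkArr f)).
pose u := @MkSquare M (MkArr f) (MkArr (ffr W (MkArr f))) _ _ H3.
by rewrite -(H u) // (@mu_unit M W (MkArr f)) // comp_idl.
Qed.

Program Definition vcoalg_cat : CatOn M VCoalg :=
  @MkCatOn M VCoalg (fun v => dom (vc_arr v)) (fun v => cod (vc_arr v))
    (fun A => MkVCoalg (co_id A)) vcoalg_cmp _ _ _ _ _ _ _.
Next Obligation. by []. Qed.
Next Obligation. by []. Qed.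
Next Obligation. by []. Qed.
Next Obligation. by []. Qed.
Next Obligation.
case: f e => [[A B f] s] e /=.
rewrite (proof_irrelevance _ e erefl) /vcoalg_cmp /=.
apply: vcoalg_eq => [|u e1 e2]; first by rewrite comp_idr.
have [u1 [u2 [[a1 b1] [[a2 b2] ->]]]] :=
  co_cmp_phi_ex (co_id A) s (free_alg (MkArr f)) u.
rewrite (@mu_unit M W (MkArr f) u2) ?comp_idl ?b2 //.
by rewrite a2 co_id_phi a1 e1.
Qed.
Next Obligation.
case: f e => [[A B f] s] e /=.
rewrite (proof_irrelevance _ e erefl) /vcoalg_cmp /=.
apply: vcoalg_eq => [|u e1 e2]; first by rewrite comp_idl.
have [u1 [u2 [[a1 b1] [[a2 b2] ->]]]] :=
  co_cmp_phi_ex s (co_id B) (free_alg (MkArr f)) u.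
rewrite co_id_phi a2 (@mu_unit M W (MkArr f) u1) ?comp_idl ?a1 //.
by rewrite b1 e2 !comp_idl.
Qed.
Next Obligation.
case: f g h e1 e2 e3 e4 => [[A B f] s] [[B' C g] t] [[C' D h] v].
move=> /= e1 e2 e3 e4; subst.
rewrite (proof_irrelevance _ e3 erefl) (proof_irrelevance _ e4 erefl).
rewrite /vcoalg_cmp /=; apply: vcoalg_eq => [|u a b]; first exact: comp_assoc.
set r := MkArr (ffr W _) in u a b *.
have [u1 [u2 [[a1 b1] [[a2 b2] ->]]]] :=
  co_cmp_phi_ex (co_cmp s t) v (free_alg (MkArr (h ∘ g ∘ f))) u.
have [u3 [u4 [[a3 b3] [[a4 b4] E4]]]] :=
  co_cmp_phi_ex s t (free_alg (MkArr (h ∘ g ∘ f))) u1.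
pose x := @MkSquare M (MkArr (h ∘ g)) r _ _ (@co_w_bot _ _ _ f (h ∘ g) s).
have [u5 [u6 [[a5 b5] [[a6 b6] E6]]]] :=
  co_cmp_phi_ex t v (free_alg (MkArr (h ∘ g ∘ f))) x.
apply: etrans _ (esym E6) => /=.
congr (_ ∘ _ ∘ _); apply: Esq_eq; last by rewrite b2 b6 b.
rewrite a2 a6; apply: etrans E4 _ => /=.
congr (_ ∘ _ ∘ _); apply: Esq_eq; last by rewrite b4 b5 b1 b.
rewrite a4 a5 /x /= /co_w.
congr (_ ∘ _ ∘ _); apply: Esq_eq; first by rewrite a3 a1 a.
by rewrite b3 b1 b /= comp_idl.
Qed.

Definition coalg_map (v w : VCoalg) (u : Square (vc_arr v) (vc_arr w)) : Prop :=
  fmap W u ∘ co_str (vc_str v) = co_str (vc_str w) ∘ bot u.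

Definition coalg_square (l r : VCoalg) (t b : Arr M) : Prop :=
  exists u : Square (vc_arr l) (vc_arr r),
    coalg_map u /\ t = MkArr (top u) /\ b = MkArr (bot u).

Lemma coalg_flat : FlatAxioms (arr_cat M) vcoalg_cat coalg_square.
Proof.
split=> /=; try by move=> l r t b [s [_ [? ?]]]; subst.
- move=> v; exists (sq_id (vc_arr v)); split=> //.
  by rewrite /coalg_map /= E_id // comp_idl comp_idr.
- move=> h; have s : idm (cod h) ∘ arr h = arr h ∘ idm (dom h).
    by rewrite comp_idl comp_idr.
  exists (@MkSquare M (MkArr (idm (dom h))) (MkArr (idm (cod h)))
               (arr h) (arr h) s); split=> //.
  exact: (ffl_nat W (@MkSquare M (MkArr (idm (dom h))) (MkArr (idm (cod h)))
               (arr h) (arr h) s)).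
- move=> l m r t b t' b' e e' [s [c [? ?]]] [s' [c' [? ?]]]; subst.
  exists (sq_hcomp s' s); split.
    rewrite /coalg_map -E_comp -comp_assoc c comp_assoc c' /=.
    by rewrite comp_assoc.
  rewrite /acomp.
  by rewrite (proof_irrelevance _ e erefl) (proof_irrelevance _ e' erefl).
- move=> [[A B f] p] [[A' B' f'] p'] [[C D g] q] [[C' D' g'] q'] t m b /= e e'.
  subst; move=> [[h k /= H] [c [/= -> ->]]].
  move=> [[h' k' /= H'] [c' [/= /MkArr_inj E ->]]]; subst h'.
  have S : g' ∘ f' ∘ h = k' ∘ (g ∘ f).
    by rewrite -comp_assoc H !comp_assoc H'.
  pose u := @MkSquare M (MkArr (g ∘ f)) (MkArr (g' ∘ f')) h k' S.
  exists u; split=> //.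
  rewrite /coalg_map /=.
  have H3 : ffr W (MkArr (g' ∘ f')) ∘ ffl W (MkArr (g' ∘ f'))
            = idm _ ∘ (g' ∘ f') by rewrite comp_idl (ff_fact W (MkArr (g' ∘ f'))).
  pose y := @MkSquare M (MkArr (g' ∘ f')) (MkArr (ffr W (MkArr (g' ∘ f')))) _ _ H3.
  rewrite -[fmap W u]comp_idl -(@mu_unit M W (MkArr (g' ∘ f')) y) //.
  rewrite -(comp_assoc _ (fmap W y)) E_comp.
  have [u1 [u2 [[a1 b1] [[a2 b2] E2]]]] :=
    co_cmp_phi_ex p q (free_alg (MkArr (g' ∘ f'))) (sq_hcomp y u).
  apply: etrans E2 _ => /=.
  rewrite /co_cmp_str -!comp_assoc -[X in _ = _ ∘ (_ ∘ X)]c' /=.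
  congr (_ ∘ _); rewrite comp_assoc E_comp; congr (_ ∘ _).
  apply: Esq_eq => /=; last by rewrite b2 /= !comp_idl.
  rewrite a2 /= /co_w -!comp_assoc -[X in _ = _ ∘ (_ ∘ X)]c /=.
  congr (_ ∘ _); rewrite comp_assoc E_comp; congr (_ ∘ _).
  apply: Esq_eq => /=; first by rewrite a1.
  by rewrite b1 /= comp_idl H'.
Qed.

Definition CoalgDouble : DoubleCategory := Flat coalg_flat.

Lemma coalg_forget_v :
  IsFunctor vcoalg_cat (arr_cat M) (fun A : M => A) vc_arr.
Proof.
split=> //= v w e e'; by rewrite (proof_irrelevance _ e' e).
Qed.

Lemma coalg_forget_sq l r t b : coalg_square l r t b ->
  commutes (vc_arr l) (vc_arr r) t b.
Proof. by move=> [u [_ ?]]; exists u. Qed.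

Lemma id_functor (O A : Type) (C : CatOn O A) :
  IsFunctor C C (fun x => x) (fun x => x).
Proof. by split=> // f g e e'; exact: cmp_irr. Qed.

Definition CoalgForget : DoubleFunctor CoalgDouble (SqDouble M) :=
  FlatFunctor _ _ (id_functor (arr_cat M)) coalg_forget_v coalg_forget_sq.

Record VAlg := MkVAlg { va_arr : Arr M; va_str : Algebra va_arr }.

Definition cast_alg (f : Arr M) (B : M) (e : cod f = B) (p : Algebra f) :
    Algebra (MkArr (castc e (arr f))) :=
  match e with erefl => p end.

Definition valg_cmp (v w : VAlg) (e : cod (va_arr v) = dom (va_arr w)) : VAlg :=
  MkVAlg (@al_cmp _ _ _ (castc e (arr (va_arr v))) (arr (va_arr w))
              (cast_alg e (va_str v)) (va_str w)).

Lemma valg_eq (A B : M) (f f' : Hom A B) (p : Algebra (MkArr f))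
    (p' : Algebra (MkArr f')) :
  f = f' ->
  (forall u : Square (MkArr (ffl W (MkArr f'))) (MkArr f),
    top u = idm A -> bot u = ffr W (MkArr f') ->
    al_str p ∘ fmap W u ∘ deltac W (MkArr f') = al_str p') ->
  MkVAlg p = MkVAlg p'.
Proof.
move=> e; subst f' => H; congr MkVAlg; apply: algebra_eq.
have H3 : f ∘ idm _ = ffr W (MkArr f) ∘ ffl W (MkArr f).
  by rewrite comp_idr (ff_fact W (MkArr f)).
pose u := @MkSquare M (MkArr (ffl W (MkArr f))) (MkArr f) _ _ H3.
by rewrite -(H u) // -comp_assoc (@delta_counit M W (MkArr f)) // comp_idr.
Qed.

Program Definition valg_cat : CatOn M VAlg :=
  @MkCatOn M VAlg (fun v => dom (va_arr v)) (fun v => cod (va_arr v))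
    (fun A => MkVAlg (al_id A)) valg_cmp _ _ _ _ _ _ _.
Next Obligation. by []. Qed.
Next Obligation. by []. Qed.
Next Obligation. by []. Qed.
Next Obligation. by []. Qed.
Next Obligation.
case: f e => [[A B f] p] e /=.
rewrite (proof_irrelevance _ e erefl) /valg_cmp /=.
apply: valg_eq => [|u e1 e2]; first by rewrite comp_idr.
have [u1 [u2 [[a1 b1] [[a2 b2] E]]]] :=
  al_cmp_phi_ex (al_id A) p (cofree_coalg (MkArr f)) u.
apply: etrans E _; rewrite al_id_phi b2 /= -comp_assoc.
rewrite (@delta_counit M W (MkArr f) u1) ?comp_idr ?b1 //.
by rewrite a1 e1 comp_idr.
Qed.
Next Obligation.
case: f e => [[A B f] p] e /=.
rewrite (proof_irrelevance _ e erefl) /valg_cmp /=.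
apply: valg_eq => [|u e1 e2]; first by rewrite comp_idl.
have [u1 [u2 [[a1 b1] [[a2 b2] E]]]] :=
  al_cmp_phi_ex p (al_id B) (cofree_coalg (MkArr f)) u.
apply: etrans E _; rewrite /= -comp_assoc.
rewrite (@delta_counit M W (MkArr f) u2) ?comp_idr ?a2 //.
by rewrite b2 al_id_phi b1 e2.
Qed.
Next Obligation.
case: f g h e1 e2 e3 e4 => [[A B f] s] [[B' C g] t] [[C' D h] v].
move=> /= e1 e2 e3 e4; subst.
rewrite (proof_irrelevance _ e3 erefl) (proof_irrelevance _ e4 erefl).
rewrite /valg_cmp /=; symmetry.
apply: valg_eq => [|u a b]; first exact/esym/comp_assoc.
have [u1 [u2 [[a1 b1] [[a2 b2] E]]]] :=
  al_cmp_phi_ex s (al_cmp t v) (cofree_coalg (MkArr (h ∘ (g ∘ f)))) u.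
apply: etrans E _.
have [u3 [u4 [[a3 b3] [[a4 b4] E4]]]] :=
  al_cmp_phi_ex t v (cofree_coalg (MkArr (h ∘ (g ∘ f)))) u1.
pose x := @MkSquare M (MkArr (ffl W (MkArr (h ∘ (g ∘ f))))) (MkArr (g ∘ f)) _ _
  (@al_v_top _ _ _ (g ∘ f) h v).
have [u5 [u6 [[a5 b5] [[a6 b6] E6]]]] :=
  al_cmp_phi_ex s t (cofree_coalg (MkArr (h ∘ (g ∘ f)))) x.
apply: etrans _ (esym E6) => /=.
congr (_ ∘ _ ∘ _); apply: Esq_eq; first by rewrite a2 a6 a.
rewrite b2 b6; apply: etrans E4 _ => /=.
congr (_ ∘ _ ∘ _); apply: Esq_eq; first by rewrite a4 a5 a1 a.
rewrite b4 b5 /x /= /al_v.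
congr (_ ∘ _ ∘ _); apply: Esq_eq; last by rewrite b3 b1 b.
by rewrite a3 a1 a /= comp_idr.
Qed.

Definition alg_map (v w : VAlg) (u : Square (va_arr v) (va_arr w)) : Prop :=
  top u ∘ al_str (va_str v) = al_str (va_str w) ∘ fmap W u.

Definition alg_square (l r : VAlg) (t b : Arr M) : Prop :=
  exists u : Square (va_arr l) (va_arr r),
    alg_map u /\ t = MkArr (top u) /\ b = MkArr (bot u).

Lemma alg_flat : FlatAxioms (arr_cat M) valg_cat alg_square.
Proof.
split=> /=; try by move=> l r t b [s [_ [? ?]]]; subst.
- move=> v; exists (sq_id (va_arr v)); split=> //.
  by rewrite /alg_map /= E_id // comp_idl comp_idr.
- move=> h; have s : idm (cod h) ∘ arr h = arr h ∘ idm (dom h).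
    by rewrite comp_idl comp_idr.
  exists (@MkSquare M (MkArr (idm (dom h))) (MkArr (idm (cod h)))
               (arr h) (arr h) s); split=> //.
  exact: (esym (ffr_nat W (@MkSquare M (MkArr (idm (dom h)))
    (MkArr (idm (cod h))) (arr h) (arr h) s))).
- move=> l m r t b t' b' e e' [s [c [? ?]]] [s' [c' [? ?]]]; subst.
  exists (sq_hcomp s' s); split.
    rewrite /alg_map -E_comp comp_assoc -c' -[RHS]comp_assoc -c /=.
    by rewrite comp_assoc.
  rewrite /acomp.
  by rewrite (proof_irrelevance _ e erefl) (proof_irrelevance _ e' erefl).
- move=> [[A B f] p] [[A' B' f'] p'] [[C D g] q] [[C' D' g'] q'] t m b /= e e'.
  subst; move=> [[h k /= H] [c [/= -> ->]]].
  move=> [[h' k' /= H'] [c' [/= /MkArr_inj E ->]]]; subst h'.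
  have S : g' ∘ f' ∘ h = k' ∘ (g ∘ f).
    by rewrite -comp_assoc H !comp_assoc H'.
  pose u := @MkSquare M (MkArr (g ∘ f)) (MkArr (g' ∘ f')) h k' S.
  exists u; split=> //.
  rewrite /alg_map /=.
  have H3 : g ∘ f ∘ idm _ = ffr W (MkArr (g ∘ f)) ∘ ffl W (MkArr (g ∘ f)).
    by rewrite comp_idr (ff_fact W (MkArr (g ∘ f))).
  pose y := @MkSquare M (MkArr (ffl W (MkArr (g ∘ f)))) (MkArr (g ∘ f)) _ _ H3.
  symmetry.
  rewrite -[fmap W u]comp_idr -(@delta_counit M W (MkArr (g ∘ f)) y) //.
  rewrite (comp_assoc (fmap W u)) E_comp comp_assoc.
  have [u1 [u2 [[a1 b1] [[a2 b2] E2]]]] :=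
    al_cmp_phi_ex p' q' (cofree_coalg (MkArr (g ∘ f))) (sq_hcomp u y).
  apply: etrans E2 _ => /=.
  rewrite /al_cmp_str !comp_assoc [X in _ = X ∘ _ ∘ _]c /=.
  congr (_ ∘ _); rewrite -comp_assoc E_comp; congr (_ ∘ _).
  apply: Esq_eq => /=; first by rewrite a2 /= !comp_idr.
  rewrite b2 /= /al_v !comp_assoc [X in _ = X ∘ _ ∘ _]c' /=.
  congr (_ ∘ _); rewrite -comp_assoc E_comp; congr (_ ∘ _).
  apply: Esq_eq => /=; last by rewrite b1.
  by rewrite a1 /= comp_idr H.
Qed.

Definition AlgDouble : DoubleCategory := Flat alg_flat.

Lemma alg_forget_v :
  IsFunctor valg_cat (arr_cat M) (fun A : M => A) va_arr.
Proof.
split=> //= v w e e'; by rewrite (proof_irrelevance _ e' e).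
Qed.

Lemma alg_forget_sq l r t b : alg_square l r t b ->
  commutes (va_arr l) (va_arr r) t b.
Proof. by move=> [u [_ ?]]; exists u. Qed.

Definition AlgForget : DoubleFunctor AlgDouble (SqDouble M) :=
  FlatFunctor _ _ (id_functor (arr_cat M)) alg_forget_v alg_forget_sq.

End CoAlg.

Definition is_awfs_left_lifting (K M : Category) (V : Functor K M)
    (W : AWFS M) (W' : AWFS K) : Prop :=
  exists Q : DoubleFunctor (CoalgDouble W') (CoalgDouble W),
    is_pullback (CoalgForget W') Q (SqFunctor V) (CoalgForget W).

Definition is_awfs_right_lifting (C M : Category) (U : Functor C M)
    (W : AWFS M) (W' : AWFS C) : Prop :=
  exists Q : DoubleFunctor (AlgDouble W') (AlgDouble W),
    is_pullback (AlgForget W') Q (SqFunctor U) (AlgForget W).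

(* Main.v *)
From Stdlib Require Import ssreflect ssrfun FunctionalExtensionality.
Require Import Defs.

Set Implicit Arguments.
Unset Strict Implicit.
Unset Printing Implicit Defensive.

Local Obligation Tactic := idtac.

(** Part (ii) of the claim fails.  The right class of a lifted algebraic weak
    factorization system consists of retracts of algebras, so it can be smaller
    than the preimage of the right class downstairs as soon as being an algebra
    of the monad is more demanding than being a retract of one.

    Take the category of families [(X_0, X_1)] of types and the monad
    [T (X_0, X_1) = (X_0 + X_1, X_0 + X_1)] induced by the adjunction between
    coproduct and diagonal; its algebras are the diagonal families [(Z, Z)].
    For any monad [T] the assignment [E f = Y * T X] for [f : X -> Y] underlies
    an algebraic weak factorization system, here [fam_awfs], whose algebras over
    the terminal object are the [T]-algebras.

    Let [U Z = (Z, unit)], which is right adjoint to evaluation at the first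
    index.  The pair [(Z, unit)] can be a [T]-algebra only if [Z] is a
    singleton, and relatively: if [U f] is an algebra, then [f] is invertible
    ([padU_reflects]).  Hence pulling algebras back along [U] yields just the
    isomorphisms, which are the algebras of the system [trivial_awfs]
    factoring [f] as [f] followed by an identity, and this system is the
    right-lifting along [U] ([trivial_right_lifting]).  Its right class consists
    of the isomorphisms.

    For an algebra of the pointed endofunctor, however, associativity is
    dropped, and [(Z, unit)] has such a structure whenever [Z] is inhabited:
    send the extra point anywhere.  So [U] sends [bool -> unit] into the right
    class ([to_unit_right]), although this map is not invertible. *)

(** * Pullbacks of double categories along monomorphisms *)

Lemma is_functor_lift (O1 A1 O2 A2 O3 A3 : Type) (C1 : CatOn O1 A1)
    (C2 : CatOn O2 A2) (C3 : CatOn O3 A3) (po : O2 -> O3) (pa : A2 -> A3)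
    (xo : O1 -> O3) (xa : A1 -> A3) (zo : O1 -> O2) (za : A1 -> A2) :
  IsFunctor C2 C3 po pa -> injective po -> injective pa ->
  IsFunctor C1 C3 xo xa ->
  (forall x, po (zo x) = xo x) -> (forall f, pa (za f) = xa f) ->
  IsFunctor C1 C2 zo za.
Proof.
move=> [ps pt pi pc] injo inja [xs xt xi xc] eo ea.
split=> [f|f|x|f g e e'].
- by apply: injo; rewrite -ps ea xs eo.
- by apply: injo; rewrite -pt ea xt eo.
- by apply: inja; rewrite pi ea xi eo.
- have e2 : tgt C3 (pa (za f)) = src C3 (pa (za g)) by rewrite pt ps e'.
  apply: inja; rewrite (pc _ _ _ e2) ea.
  move: e2; rewrite !ea => e2.
  exact: xc.
Qed.

(** When the projection [P] is injective in every component, the functor laws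
    and the uniqueness of a mediating double functor are inherited through [P],
    so only its underlying functions need to be given. *)
Lemma pullback_of_injective (D A B C : DoubleCategory)
    (P : DoubleFunctor D A) (Q : DoubleFunctor D B)
    (F : DoubleFunctor A C) (G : DoubleFunctor B C) :
  injective (dfO P) -> injective (dfH P) ->
  injective (dfV P) -> injective (dfS P) ->
  df_eq (df_comp F P) (df_comp G Q) ->
  (forall (T : DoubleCategory) (X : DoubleFunctor T A) (Y : DoubleFunctor T B),
    df_eq (df_comp F X) (df_comp G Y) ->
    exists (zO : DOb T -> DOb D) (zH : DHor T -> DHor D)
           (zV : DVer T -> DVer D) (zS : DSq T -> DSq D),
      ((forall x, dfO P (zO x) = dfO X x) /\ (forall x, dfH P (zH x) = dfH X x) /\
       (forall x, dfV P (zV x) = dfV X x) /\ (forall x, dfS P (zS x) = dfS X x)) /\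
      ((forall x, dfO Q (zO x) = dfO Y x) /\ (forall x, dfH Q (zH x) = dfH Y x) /\
       (forall x, dfV Q (zV x) = dfV Y x) /\ (forall x, dfS Q (zS x) = dfS Y x))) ->
  is_pullback P Q F G.
Proof.
move=> injO injH injV injS comm lift; split=> // T X Y /lift.
move=> [zO [zH [zV [zS [[PO [PH [PV PS]]] [QO [QH [QV QS]]]]]]]].
exists (@MkDoubleFunctor T D zO zH zV zS
  (is_functor_lift (df_hobj P) injO injH (df_hobj X) PO PH)
  (is_functor_lift (df_hver P) injV injS (df_hver X) PV PS)
  (is_functor_lift (df_vobj P) injO injV (df_vobj X) PO PV)
  (is_functor_lift (df_vhor P) injH injS (df_vhor X) PH PS)).
split=> // Z' [/= EO EH EV ES] _; split=> /= x.
- by apply: injO; rewrite EO PO.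
- by apply: injH; rewrite EH PH.
- by apply: injV; rewrite EV PV.
- by apply: injS; rewrite ES PS.
Qed.

(** * Algebra structures on isomorphisms *)

Definition is_inverse (M : Category) (f : Arr M) (p : Hom (cod f) (dom f)) :
    Prop :=
  p ∘ arr f = idm (dom f) /\ arr f ∘ p = idm (cod f).

Arguments is_inverse {M} f p.

Lemma inverse_cancel (M : Category) (f : Arr M) p (A : M)
    (a b : Hom A (dom f)) :
  is_inverse f p -> arr f ∘ a = arr f ∘ b -> a = b.
Proof.
move=> [pf _] e.
by rewrite -(comp_idl a) -(comp_idl b) -pf -!comp_assoc e.
Qed.

Section AlgebrasOnIsos.
Variables (M : Category) (W : AWFS M).

(** An isomorphism is the pullback of an identity, so it carries an algebra
    structure, and being monic it has no other one. *)
Program Definition iso_alg (f : Arr M) p (fp : is_inverse f p) : Algebra W f :=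
  @MkAlgebra M W f (p ∘ ffr W f) _ _ _.
Next Obligation.
by move=> f p [pf fp]; rewrite -comp_assoc ff_fact pf.
Qed.
Next Obligation.
by move=> f p [pf fp]; rewrite comp_assoc fp comp_idl.
Qed.
Next Obligation.
move=> f p fp /=; rewrite -!comp_assoc muR; congr (_ ∘ _).
by rewrite ffr_nat /= comp_idl.
Qed.

Lemma valg_eq_iso (v w : VAlg W) (p : Hom (cod (va_arr v)) (dom (va_arr v))) :
  is_inverse (va_arr v) p -> va_arr v = va_arr w -> v = w.
Proof.
case: v w p => [f a] [g b] /= p fp e; subst g; congr MkVAlg.
apply: algebra_eq; apply: (inverse_cancel fp).
by rewrite !al_right.
Qed.

(** Both composites in the compatibility condition agree after composition with
    the target arrow, by naturality of the right factor. *)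
Lemma alg_map_iso (v w : VAlg W) (p : Hom (cod (va_arr w)) (dom (va_arr w)))
    (u : Square (va_arr v) (va_arr w)) :
  is_inverse (va_arr w) p -> alg_map u.
Proof.
move=> wp; apply: (inverse_cancel wp).
by rewrite !comp_assoc sq_comm -comp_assoc !al_right ffr_nat.
Qed.

End AlgebrasOnIsos.

Lemma fmap_inverse (C M : Category) (U : Functor C M) (f : Arr C) p :
  is_inverse f p -> is_inverse (arr_map U f) (fmap U p).
Proof. by move=> [pf fp]; split; rewrite -fmap_comp /= ?pf ?fp fmap_id. Qed.

(** * The system whose algebras are the isomorphisms *)

Section Trivial.
Variable C : Category.

Program Definition trivial_ff : FunctorialFactorization C :=
  @MkFF C (@MkFunctor (ArrowCat C) C (fun f => cod f)
            (fun f g (s : Square f g) => bot s) (fun _ => erefl)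
            (fun _ _ _ _ _ => erefl))
    (fun f => arr f) (fun f => idm (cod f)) _ _ _.
Next Obligation. by move=> f /=; rewrite comp_idl. Qed.
Next Obligation. by move=> f g s /=; rewrite sq_comm. Qed.
Next Obligation. by move=> f g s /=; rewrite comp_idl comp_idr. Qed.

Program Definition trivial_delta :
    NatTrans (ffL trivial_ff) (functor_comp (ffL trivial_ff) (ffL trivial_ff)) :=
  @MkNatTrans (ArrowCat C) (ArrowCat C) _ _
    (fun f => @MkSquare C (MkArr (arr f)) (MkArr (arr f)) (idm _) (idm _) _) _.
Next Obligation. by move=> f /=; rewrite comp_idl comp_idr. Qed.
Next Obligation.
by move=> f g s; apply: sq_eq; rewrite /= comp_idl comp_idr.
Qed.

Program Definition trivial_mu :
    NatTrans (functor_comp (ffR trivial_ff) (ffR trivial_ff)) (ffR trivial_ff) :=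
  @MkNatTrans (ArrowCat C) (ArrowCat C) _ _
    (fun f => @MkSquare C (MkArr (idm (cod f))) (MkArr (idm (cod f)))
       (idm _) (idm _) _) _.
Next Obligation. by []. Qed.
Next Obligation.
by move=> f g s; apply: sq_eq; rewrite /= comp_idl comp_idr.
Qed.

Program Definition trivial_lam :
    NatTrans (functor_comp (ffL trivial_ff) (ffR trivial_ff))
             (functor_comp (ffR trivial_ff) (ffL trivial_ff)) :=
  @MkNatTrans (ArrowCat C) (ArrowCat C) _ _
    (fun f => @MkSquare C (MkArr (idm (cod f))) (MkArr (idm (cod f)))
       (idm _) (idm _) _) _.
Next Obligation. by []. Qed.
Next Obligation.
by move=> f g s; apply: sq_eq; rewrite /= comp_idl comp_idr.
Qed.

Program Definition trivial_awfs : AWFS C :=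
  @MkAWFS C trivial_ff trivial_delta trivial_mu _ _ _.
Next Obligation. by split=> f; apply: sq_eq; rewrite /= ?comp_idl. Qed.
Next Obligation. by split=> f; apply: sq_eq; rewrite /= ?comp_idl. Qed.
Next Obligation.
exists trivial_lam; split=> [f|]; first by [].
by split=> f; apply: sq_eq; rewrite /= ?comp_idl ?comp_idr.
Qed.

(** Since the right factor is an identity, the two unit laws of an algebra are
    the two inverse laws. *)
Lemma trivial_alg_inverse (f : Arr C) (a : Algebra trivial_awfs f) :
  is_inverse f (al_str a).
Proof. by split; [exact: (al_unit a) | exact: (al_right a)]. Qed.

Lemma trivial_forget_inj : injective (dfV (AlgForget trivial_awfs)).
Proof. by move=> v w; exact: (valg_eq_iso (trivial_alg_inverse (va_str v))). Qed.

Lemma trivial_alg_square (v w : VAlg trivial_awfs) t b :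
  commutes (va_arr v) (va_arr w) t b -> alg_square v w t b.
Proof.
move=> [u [-> ->]]; exists u; split=> //.
exact: alg_map_iso (trivial_alg_inverse (va_str w)).
Qed.

End Trivial.

(** * Right-lifting when algebras upstairs are invertible *)

Section TrivialLifting.
Variables (C M : Category) (U : Functor C M) (W : AWFS M).
Hypothesis reflect : forall f : Arr C, Algebra W (arr_map U f) ->
  {p : Hom (cod f) (dom f) | is_inverse f p}.

Let W' := trivial_awfs C.

Lemma valg_inverse (v : VAlg W') :
  is_inverse (arr_map U (va_arr v)) (fmap U (al_str (va_str v))).
Proof. exact: fmap_inverse (trivial_alg_inverse (va_str v)). Qed.

Definition lift_valg (v : VAlg W') : VAlg W :=
  MkVAlg (iso_alg W (valg_inverse v)).

Lemma lift_valg_eq (v : VAlg W') (w : VAlg W) :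
  arr_map U (va_arr v) = va_arr w -> lift_valg v = w.
Proof. exact: (valg_eq_iso (v := lift_valg v) (valg_inverse v)). Qed.

Lemma lift_valg_functor :
  IsFunctor (valg_cat W') (valg_cat W) U lift_valg.
Proof.
split=> // [A|v w e e'].
  apply: lift_valg_eq; exact: (fun_idn (arr_map_functor U) A).
apply: lift_valg_eq; exact: (fun_cmp (arr_map_functor U)).
Qed.

Lemma lift_valg_square l r t b : alg_square l r t b ->
  alg_square (lift_valg l) (lift_valg r) (arr_map U t) (arr_map U b).
Proof.
move=> /alg_forget_sq /(arr_map_commutes U) [u [-> ->]]; exists u; split=> //.
exact: (alg_map_iso (v := lift_valg l) (w := lift_valg r) u (valg_inverse r)).
Qed.

(** An arrow [f] carries an algebra structure for the trivial system precisely
    when [U f] carries one for [W]; all such structures are unique and every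
    square between them is a map of algebras, so the comparison of double
    categories reduces to a comparison of the underlying arrows. *)
Lemma trivial_right_lifting : is_awfs_right_lifting U W W'.
Proof.
exists (FlatFunctor (alg_flat W') (alg_flat W) (arr_map_functor U)
          lift_valg_functor lift_valg_square).
apply: pullback_of_injective => //.
- exact: trivial_forget_inj.
- move=> a b e; apply: flat_eq.
  + exact: (trivial_forget_inj (f_equal (@fs_left _ _ _) e)).
  + exact: (trivial_forget_inj (f_equal (@fs_right _ _ _) e)).
  + exact: (f_equal (@fs_top _ _ _) e).
  + exact: (f_equal (@fs_bot _ _ _) e).
- by split=> //= a; exact: flat_eq.
- move=> T X Y [/= EO EH EV ES].
  have lift (f : Arr C) (v : VAlg W) : arr_map U f = va_arr v -> Algebra W' f.
    case: v => g a /= e; subst g.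
    exact: iso_alg (proj2_sig (reflect a)).
  pose zV v := MkVAlg (lift _ _ (EV v)).
  have lcomm (s : DSq T) :
      commutes (va_arr (zV (src (hver T) s))) (va_arr (zV (tgt (hver T) s)))
        (fs_top (dfS X s)) (fs_bot (dfS X s)).
    rewrite /= -(fun_src (df_hver X)) -(fun_tgt (df_hver X)).
    exact: (fs_prop (dfS X s)).
  pose zS s := MkFlatSq (trivial_alg_square (lcomm s)).
  exists (dfO X), (dfH X), zV, zS; split; split=> //; split=> //; split=> //.
  + move=> s; apply: flat_eq => //=; first exact/esym/(fun_src (df_hver X)).
    exact/esym/(fun_tgt (df_hver X)).
  + move=> v; apply: lift_valg_eq; exact: EV.
  + move=> s; apply: flat_eq => /=.
    * rewrite [RHS](fun_src (df_hver Y)).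
      apply: lift_valg_eq; exact: EV.
    * rewrite [RHS](fun_tgt (df_hver Y)).
      apply: lift_valg_eq; exact: EV.
    * exact: (f_equal (@fs_top _ _ _) (ES s)).
    * exact: (f_equal (@fs_bot _ _ _) (ES s)).
Qed.

End TrivialLifting.

(** * Families of types and the coproduct monad *)

Definition TypeCat : Category :=
  @MkCategory Type (fun A B => A -> B) (fun _ x => x)
    (fun _ _ _ g f x => g (f x)) (fun _ _ _ => erefl) (fun _ _ _ => erefl)
    (fun _ _ _ _ _ _ _ => erefl).

Section Families.
Variable I : Type.

Definition FamCat : Category :=
  @MkCategory (I -> Type) (fun X Y => forall i, X i -> Y i) (fun _ _ x => x)
    (fun _ _ _ g f i x => g i (f i x)) (fun _ _ _ => erefl) (fun _ _ _ => erefl)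
    (fun _ _ _ _ _ _ _ => erefl).

Lemma fam_ext (X Y : FamCat) (f g : Hom X Y) :
  (forall i x, f i x = g i x) -> f = g.
Proof.
move=> e; apply: functional_extensionality_dep => i.
by apply: functional_extensionality_dep.
Qed.

Lemma fam_app (X Y : FamCat) (f g : Hom X Y) :
  f = g -> forall i x, f i x = g i x.
Proof. by move=> ->. Qed.

(** [cod f * T (dom f)], where [T X] is the constant family at the coproduct of
    the members of [X]. *)
Definition fam_E (f : Arr FamCat) : FamCat :=
  fun i => (cod f i * {j : I & dom f j})%type.

Definition fam_E_map (f g : Arr FamCat) (s : Square f g) :
    Hom (fam_E f) (fam_E g) :=
  fun i z => (bot s i z.1, existT _ (projT1 z.2) (top s _ (projT2 z.2))).

Program Definition fam_ff : FunctorialFactorization FamCat :=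
  @MkFF FamCat (@MkFunctor (ArrowCat FamCat) FamCat fam_E fam_E_map _ _)
    (fun f i x => (arr f i x, existT _ i x)) (fun f i z => z.1) _ _ _.
Next Obligation. by move=> f; apply: fam_ext => i [y [j x]]. Qed.
Next Obligation. by []. Qed.
Next Obligation. by []. Qed.
Next Obligation.
move=> f g s; apply: fam_ext => i x; rewrite /= /fam_E_map /=; congr pair.
exact: (esym (fam_app (sq_comm s) x)).
Qed.
Next Obligation. by []. Qed.

(** Coalgebras [B -> E f] amount to extensions of the unit [A -> T A] along
    [f : A -> B]; the cofree one on [f] is the projection [cod f * T A -> T A]. *)
Program Definition fam_delta :
    NatTrans (ffL fam_ff) (functor_comp (ffL fam_ff) (ffL fam_ff)) :=
  @MkNatTrans (ArrowCat FamCat) (ArrowCat FamCat) _ _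
    (fun f => @MkSquare FamCat (MkArr (ffl fam_ff f))
       (MkArr (ffl fam_ff (MkArr (ffl fam_ff f))))
       (idm _) (fun i z => (z, z.2)) _) _.
Next Obligation. by []. Qed.
Next Obligation. by move=> f g s; exact: sq_eq. Qed.

(** Induced by the multiplication of the monad [T], which forgets the outer of
    two nested indices. *)
Program Definition fam_mu :
    NatTrans (functor_comp (ffR fam_ff) (ffR fam_ff)) (ffR fam_ff) :=
  @MkNatTrans (ArrowCat FamCat) (ArrowCat FamCat) _ _
    (fun f => @MkSquare FamCat (MkArr (ffr fam_ff (MkArr (ffr fam_ff f))))
       (MkArr (ffr fam_ff f))
       (fun i z => (z.1, (projT2 z.2).2)) (idm _) _) _.
Next Obligation. by []. Qed.
Next Obligation. by move=> f g s; exact: sq_eq. Qed.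

Program Definition fam_lam :
    NatTrans (functor_comp (ffL fam_ff) (ffR fam_ff))
             (functor_comp (ffR fam_ff) (ffL fam_ff)) :=
  @MkNatTrans (ArrowCat FamCat) (ArrowCat FamCat) _ _
    (fun f => @MkSquare FamCat (MkArr (ffl fam_ff (MkArr (ffr fam_ff f))))
       (MkArr (ffr fam_ff (MkArr (ffl fam_ff f))))
       (bot (fam_delta f)) (top (fam_mu f)) _) _.
Next Obligation. by move=> f; apply: fam_ext => i [y u]. Qed.
Next Obligation. by move=> f g s; exact: sq_eq. Qed.

Program Definition fam_awfs : AWFS FamCat :=
  @MkAWFS FamCat fam_ff fam_delta fam_mu _ _ _.
Next Obligation.
by split=> f; apply: sq_eq => //; apply: fam_ext => i [y [j x]].
Qed.
Next Obligation.
by split=> f; apply: sq_eq => //; apply: fam_ext => i [y [j x]].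
Qed.
Next Obligation.
exists fam_lam; split=> [f|]; first by [].
by split=> f; apply: sq_eq => //; apply: fam_ext => i [y [j x]] //; case: x.
Qed.

End Families.

(** * The counterexample *)

Definition pad (A : Type) : bool -> Type := fun i => if i then A else unit.

Definition pad_map (A B : Type) (f : A -> B) i : pad A i -> pad B i :=
  match i with true => f | false => fun u => u end.

Program Definition padU : Functor TypeCat (FamCat bool) :=
  @MkFunctor TypeCat (FamCat bool) pad pad_map _ _.
Next Obligation. by move=> A; apply: fam_ext => -[]. Qed.
Next Obligation. by move=> A B D g f; apply: fam_ext => -[]. Qed.

Definition eval_true : Functor (FamCat bool) TypeCat :=
  @MkFunctor (FamCat bool) TypeCat (fun X => X true) (fun X Y f => f true)
    (fun _ => erefl) (fun _ _ _ _ _ => erefl).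

Program Definition pad_unit :
    NatTrans (functor_id (FamCat bool)) (functor_comp padU eval_true) :=
  @MkNatTrans (FamCat bool) (FamCat bool) _ _
    (fun X i => match i with true => fun x => x | false => fun _ => tt end) _.
Next Obligation. by move=> X Y f; apply: fam_ext => -[]. Qed.

Definition pad_counit :
    NatTrans (functor_comp eval_true padU) (functor_id TypeCat) :=
  @MkNatTrans TypeCat TypeCat (functor_comp eval_true padU) (functor_id TypeCat)
    (fun A (x : A) => x) (fun _ _ _ => erefl).

Lemma padU_right_adjoint : is_right_adjoint padU.
Proof.
exists eval_true; constructor; exists pad_unit pad_counit => // A.
by apply: fam_ext => -[] // [].
Qed.

(** Let [p : B * (A + unit) -> A] be the component at [true] of an algebra
    structure on [U f], with [f : A -> B].  Associativity evaluated at
    [p (b, a)], viewed in the copy of the coproduct indexed by [false], says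
    [p (b, a) = p (b, tt)], because the component at [false] takes values in
    [unit] and forgets [a].  Thus [b |-> p (b, tt)] is inverse to [f]. *)
Lemma padU_reflects (f : Arr TypeCat) :
  Algebra (fam_awfs bool) (arr_map padU f) ->
  {p : Hom (cod f) (dom f) | is_inverse f p}.
Proof.
move=> a.
exists (fun b => al_str a true (b, existT _ false tt)).
split; apply: functional_extensionality => x /=.
- have /= au := fam_app (al_unit a) (i := true) x.
  have tu : forall u : unit, u = tt by case.
  have := fam_app (al_assoc a) (i := true)
    (arr f x, existT _ false (tt, existT _ true x)).
  rewrite /muc /= au => /esym; apply: etrans.
  congr (al_str a true _).
  by rewrite /Esq /= /fam_E_map /= (tu (al_str a false _)).
- exact: (fam_app (al_right a) (i := true) (x, existT _ false tt)).
Qed.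

Definition to_unit : @Hom TypeCat bool unit := fun _ => tt.

(** The extra point contributed by the index [false] is sent to [true]; only the
    unit laws constrain this choice. *)
Lemma to_unit_right : preimage padU (awfs_right (fam_awfs bool)) to_unit.
Proof.
exists (fun i => match i return pad unit i * {j & pad bool j} -> pad bool i with
  | true => fun z =>
      match z.2 with existT _ true b => b | existT _ false _ => true end
  | false => fun _ => tt
  end).
by split; apply: fam_ext => -[] // [] //; case.
Qed.

Theorem proposition3p11 :
  ~ (forall (M : Category) (W : AWFS M),
      (forall (K : Category) (V : Functor K M), is_left_adjoint V ->
         forall W' : AWFS K, is_awfs_left_lifting V W W' ->
         is_wfs_left_lifting V (underlying_wfs W) (underlying_wfs W'))
      /\
      (forall (C : Category) (U : Functor C M), is_right_adjoint U ->
         forall W'' : AWFS C, is_awfs_right_lifting U W W'' ->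
         is_wfs_right_lifting U (underlying_wfs W) (underlying_wfs W''))).
Proof.
move=> claim.
have [_ right] := claim _ (fam_awfs bool).
have [_ eqR] := right _ _ padU_right_adjoint _
  (trivial_right_lifting padU_reflects).
have [p [pg _]] := (eqR _ _ to_unit).2 to_unit_right.
have pE (b : bool) : p tt = b := f_equal (fun h => h b) pg.
by have := etrans (esym (pE true)) (pE false).
Qed.
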